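(* Let $d\ge2$ be an integer and $q$ a prime power. For every real $r>0$, $$\int_Y\alpha(x)^r\,d\nu(x)<\infty\quad\Longleftrightarrow\quad 0<r<d.$$ The same criterion holds with the probability measure $\mu=\nu/\nu(Y)$ in place of $\nu$.
   Context: Let $q$ be a prime power, $d\ge2$ an integer, $F=\mathbb F_q(\!(t^{-1})\!)$ with valuation ring $\mathcal O=\mathbb F_q[\![t^{-1}]\!]$ and absolute value normalized by $|t|=q$. Put $G=\operatorname{PGL}_d(F)$, $K=\operatorname{PGL}_d(\mathcal O)$, $\Gamma=\operatorname{PGL}_d(\mathbb F_q[t])$. Haar measure on $G$ is normalized by $\operatorname{vol}(K)=1$. Put $Y=\Gamma\backslash G/K$ (a countable set), and let $\nu$ be the measure on $Y$ induced from the Haar measure of $G$, i.e. the push-forward to $Y$ of the quotient measure on $\Gamma\backslash G$; equivalently each point $\Gamma gK$ has mass $1/|\Gamma\cap gKg^{-1}|$. The total mass $\nu(Y)$ is finite, and $\mu=\nu/\nu(Y)$. Height function $\alpha$. Let $\Lambda_0=\mathbb F_q[t]^d\subset F^d$. Use the max norm on $F^d$ and on each $\bigwedge^jF^d$ the sup norm in the standard exterior basis. For a rank-$d$ $\mathbb F_q[t]$-lattice $\Lambda=g\Lambda_0$, $g\in\operatorname{GL}_d(F)$, put $\operatorname{covol}(\Lambda)=|\det g|$. For the homothety class $[\Lambda]$ define $$\alpha([\Lambda])=\max_{1\le j\le d}\left\{\operatorname{covol}(\Lambda)^{j/d}\,\|v_1\wedge\cdots\wedge v_j\|^{-1}: v_1,\ldots,v_j\in\Lambda\text{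 are $F$-linearly independent}\right\}.$$ This is invariant under homotheties. On $Y$ define $\alpha(\Gamma gK)=\alpha([g^{-1}\Lambda_0])$, which is well-defined because $K$ acts by isometries and $\Gamma$ preserves $[\Lambda_0]$. *)

(* Defs.v *)
From HB Require Import structures.
From mathcomp Require Import all_boot all_order all_algebra.
From mathcomp Require Import all_classical all_reals all_analysis.
From mathcomp Require Import measurable_realfun.
From mathcomp Require Import zify.

Set Implicit Arguments.
Unset Strict Implicit.
Unset Printing Implicit Defensive.

Import Order.TTheory GRing.Theory Num.Theory.

Local Open Scope classical_set_scope.
Local Open Scope ring_scope.

(* The field k((t^-1)): the series \sum_n a_n t^n with a_n = 0 for all large n,
   represented by their coefficients n |-> a_n. *)
Record laurent (k : fieldType) := Laurent {
  lcoef :> int -> k;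
  lbounded : exists N : int, forall n, N < n -> lcoef n = 0 }.

HB.instance Definition _ (k : fieldType) := gen_eqMixin (laurent k).
HB.instance Definition _ (k : fieldType) := gen_choiceMixin (laurent k).

Section LaurentField.
Variable k : fieldType.
Local Notation L := (laurent k).
Implicit Types x y z : L.

Lemma laurentP x y : (forall n, x n = y n) -> x = y.
Proof.
case: x y => [f hf] [g hg] /= /funext fg; subst g.
by congr Laurent; exact: Prop_irrelevance.
Qed.

Fact zero_bounded : exists N : int, forall n, N < n -> (fun=> 0 : k) n = 0.
Proof. by exists 0. Qed.
Definition lzero : L := Laurent zero_bounded.

Fact one_bounded :
  exists N : int, forall n : int, N < n -> (n == 0)%:R = 0 :> k.
Proof. by exists 0 => n; rewrite lt_neqAle eq_sym => /andP[/negPf->]. Qed.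
Definition lone : L := Laurent one_bounded.

Fact opp_bounded x : exists N : int, forall n, N < n -> - x n = 0.
Proof. by have [N xN] := lbounded x; exists N => n /xN ->; rewrite oppr0. Qed.
Definition lopp x : L := Laurent (opp_bounded x).

Fact add_bounded x y : exists N : int, forall n, N < n -> x n + y n = 0.
Proof.
have [N xN] := lbounded x; have [M yM] := lbounded y.
exists (Num.max N M) => n; rewrite gt_max => /andP[/xN-> /yM->].
by rewrite addr0.
Qed.
Definition ladd x y : L := Laurent (add_bounded x y).

(* The sum is finitely supported, see [lmul_coefE]. *)
Definition lmul_coef x y (n : int) : k :=
  \sum_(i \in [set: int]) x i * y (n - i).

Lemma lmul_coef0 x y (N M : int) :
  (forall n, N < n -> x n = 0) -> (forall n, M < n -> y n = 0) ->
  forall n, N + M < n -> lmul_coef x y n = 0.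
Proof.
move=> xN yM n nNM; apply: fsbig1 => i _.
have [/xN->|iN] := ltP N i; first by rewrite mul0r.
by rewrite (yM (n - i)) ?mulr0// ltrBrDl (le_lt_trans _ nNM)// lerD2r.
Qed.

Lemma lmul_coefE x y (N M : int) :
  (forall n, N < n -> x n = 0) -> (forall n, M < n -> y n = 0) ->
  forall j : nat, lmul_coef x y (N + M - j%:Z) =
    \sum_(i < j.+1) x (N - i%:Z) * y (M - (j - i)%N%:Z).
Proof.
move=> xN yM j; rewrite /lmul_coef.
pose h (i : nat) : int := N - i%:Z.
have hinj : set_inj `I_j.+1 h.
  by move=> a b _ _ /addrI/oppr_inj[].
rewrite -(@fsbig_widen _ _ _ _ (h @` `I_j.+1) setT)//; last first.
  move=> i [_ /= hi].
  have [/xN->|iN] := ltP N i; first by rewrite mul0r.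
  rewrite yM ?mulr0//; apply: contrapT => /negP; rewrite -leNgt => le.
  apply: hi; exists `|N - i|%N; last first.
    by rewrite /h gez0_abs ?subr_ge0// opprB addrC subrK.
  by rewrite /=; move: le iN; lia.
rewrite fsbig_image// -fsbig_ord; apply: eq_bigr => i _; congr (_ * y _).
by rewrite /h; have := leq_ord i; lia.
Qed.

Fact mul_bounded x y : exists N : int, forall n, N < n -> lmul_coef x y n = 0.
Proof.
have [N xN] := lbounded x; have [M yM] := lbounded y.
by exists (N + M); exact: lmul_coef0.
Qed.
Definition lmul x y : L := Laurent (mul_bounded x y).

(* The coefficients of t^N, ..., t^(N-m+1), as a polynomial in t^-1. *)
Definition trunc (m : nat) (N : int) (f : int -> k) : {poly k} :=
  \poly_(i < m) f (N - i%:Z).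

Fact coef_mul_eq (p p' q : {poly k}) (m j : nat) : (j < m)%N ->
  (forall i, (i < m)%N -> p`_i = p'`_i) -> (p * q)`_j = (p' * q)`_j.
Proof.
move=> jm pp'; rewrite !coefM; apply: eq_bigr => i _.
by rewrite pp'// (leq_ltn_trans (leq_ord i)).
Qed.

Fact truncM x y (N M : int) (m j : nat) :
  (forall n, N < n -> x n = 0) -> (forall n, M < n -> y n = 0) ->
  (j < m)%N -> lmul x y (N + M - j%:Z) = (trunc m N x * trunc m M y)`_j.
Proof.
move=> xN yM jm; rewrite /= lmul_coefE// coefM; apply: eq_bigr => i _.
rewrite !coef_poly (leq_ltn_trans (leq_ord i))//.
by rewrite (leq_ltn_trans (leq_subr _ _)).
Qed.

Fact laurentP_bounded x y (N : int) :
  (forall n, N < n -> x n = 0) -> (forall n, N < n -> y n = 0) ->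
  (forall j : nat, x (N - j%:Z) = y (N - j%:Z)) -> x = y.
Proof.
move=> xN yN xy; apply: laurentP => n.
have [Nn|nN] := ltP N n; first by rewrite xN// yN.
have -> : n = N - `|N - n|%N%:Z by lia.
exact: xy.
Qed.

Lemma laddA : associative ladd.
Proof. by move=> x y z; apply: laurentP => n /=; rewrite addrA. Qed.
Lemma laddC : commutative ladd.
Proof. by move=> x y; apply: laurentP => n /=; rewrite addrC. Qed.
Lemma ladd0x : left_id lzero ladd.
Proof. by move=> x; apply: laurentP => n /=; rewrite add0r. Qed.
Lemma laddNx : left_inverse lzero lopp ladd.
Proof. by move=> x; apply: laurentP => n /=; rewrite addNr. Qed.

Lemma lmulC : commutative lmul.
Proof.
move=> x y; have [N xN] := lbounded x; have [M yM] := lbounded y.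
apply: (@laurentP_bounded _ _ (N + M)).
- exact: lmul_coef0.
- by rewrite addrC; exact: lmul_coef0.
- move=> j; rewrite (truncM (m := j.+1))// [N + M]addrC (truncM (m := j.+1))//.
  by rewrite mulrC.
Qed.

Fact lmulAl x y z (A B C : int) (j : nat) :
  (forall n, A < n -> x n = 0) -> (forall n, B < n -> y n = 0) ->
  (forall n, C < n -> z n = 0) ->
  lmul (lmul x y) z (A + B + C - j%:Z) =
  (trunc j.+1 A x * trunc j.+1 B y * trunc j.+1 C z)`_j.
Proof.
move=> xA yB zC; rewrite (truncM (m := j.+1))//; last exact: lmul_coef0.
apply: (@coef_mul_eq _ _ _ j.+1) => // i ij.
by rewrite coef_poly ij (truncM (m := j.+1)).
Qed.

Lemma lmulA : associative lmul.
Proof.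
move=> x y z; have [A xA] := lbounded x; have [B yB] := lbounded y.
have [C zC] := lbounded z; rewrite (lmulC x).
have E : A + B + C = B + C + A by rewrite -addrA addrC.
apply: (@laurentP_bounded _ _ (A + B + C)).
- rewrite E; apply: lmul_coef0 => //; exact: lmul_coef0.
- apply: lmul_coef0 => //; exact: lmul_coef0.
- move=> j; rewrite (lmulAl _ xA yB zC) E.
  by rewrite (lmulAl _ yB zC xA) mulrC mulrA.
Qed.

Lemma lmul1x : left_id lone lmul.
Proof.
move=> x; have [N xN] := lbounded x.
have b1 (n : int) : 0 < n -> lone n = 0.
  by rewrite /= lt_neqAle eq_sym => /andP[/negPf->].
apply: (@laurentP_bounded _ _ N) => //.
  by rewrite -[N]add0r; exact: lmul_coef0.
move=> j; rewrite -[X in lmul _ _ (X - _)]add0r /= lmul_coefE//.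
rewrite big_ord_recl big1 => [|i _]; last first.
  have /negPf h : (0 : int) - (lift ord0 i : nat)%:Z != 0 by rewrite lift0; lia.
  have -> : lone (0 - (lift ord0 i : nat)%:Z) =
    ((0 : int) - (lift ord0 i : nat)%:Z == 0)%:R by [].
  by rewrite h mul0r.
by rewrite addr0 subn0 [lone _](_ : _ = 1) ?mul1r.
Qed.

Lemma lmulDl : left_distributive lmul ladd.
Proof.
move=> x y z; have [A xA] := lbounded x; have [B yB] := lbounded y.
have [C zC] := lbounded z; pose M := Num.max A B.
have xM n : M < n -> x n = 0 by rewrite gt_max => /andP[/xA].
have yM n : M < n -> y n = 0 by rewrite gt_max => /andP[_ /yB].
have xyM n : M < n -> ladd x y n = 0 by move=> Mn /=; rewrite xM// yM// addr0.
apply: (@laurentP_bounded _ _ (M + C)).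
- exact: lmul_coef0.
- by move=> n Mn /=; rewrite !(@lmul_coef0 _ _ M C)// addr0.
- move=> j; rewrite [RHS]/= /= !lmul_coefE// -big_split /=.
  by apply: eq_bigr => i _; rewrite mulrDl.
Qed.

Lemma lone_neq0 : lone <> lzero.
Proof. by move=> /(congr1 (fun x : L => x 0)) /= /eqP; rewrite oner_eq0. Qed.

Fact power_series_inverse (a : nat -> k) : a 0%N != 0 -> exists b : nat -> k,
  forall j, \sum_(i < j.+1) a i * b (j - i)%N = (j == 0)%:R.
Proof.
move=> a0; pose next (s : seq k) : k :=
  ((size s == 0%N)%:R - \sum_(i < size s) a i.+1 * s`_(size s - i.+1)) / a 0%N.
pose s := fix s n := if n is n'.+1 then rcons (s n') (next (s n')) else [::].
have ss n : size (s n) = n by elim: n => //= n IH; rewrite size_rcons IH.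
have sn n m i : (i < n)%N -> (s (n + m)%N)`_i = (s n)`_i.
  move=> ilt; elim: m => [|m IH]; first by rewrite addn0.
  by rewrite addnS /= nth_rcons ss (leq_trans ilt) ?leq_addr.
exists (fun n => (s n.+1)`_n) => j; rewrite big_ord_recl subn0.
rewrite [(s j.+1)`_j]/= nth_rcons ss ltnn eqxx /next ss.
rewrite [a _ * _]mulrC divfK// -[RHS](subrK
  (\sum_(i < j) a i.+1 * (s j)`_(j - i.+1))); congr (_ + _).
apply: eq_bigr => i _; congr (_ * _).
rewrite /= /bump /= add1n.
have -> : s j = s ((j - i.+1).+1 + i)%N by congr s; have := ltn_ord i; lia.
by rewrite sn.
Qed.

Fact linv_exists x : x <> lzero -> exists y, lmul y x = lone.
Proof.
move=> x0; have [M xM] := lbounded x.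
have [j xj] : exists j : nat, x (M - j%:Z) != 0.
  apply: contrapT => /forallNP x00; apply: x0.
  apply: (laurentP_bounded xM) => // j.
  by apply/eqP; apply: contra_notT (x00 j).
have [i xi imin] := ex_minnP (ex_intro (fun j : nat => x (M - j%:Z) != 0) j xj).
pose N := M - i%:Z.
have xN n : N < n -> x n = 0.
  move=> Nn; have [/xM//|nM] := ltP M n; apply/eqP; apply: contraT => xn.
  have := imin `|M - n|%N; rewrite (_ : M - _ = n); last by lia.
  by move=> /(_ xn); rewrite /N in Nn; lia.
have [|b ab] := @power_series_inverse (fun n => x (N - n%:Z)).
  by rewrite subr0.
have y_bounded : exists B : int, forall n : int, B < n ->
    (if n <= - N then b `|- N - n|%N else 0) = 0.
  by exists (- N) => n; rewrite ltNge => /negPf->.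
exists (Laurent y_bounded); rewrite lmulC.
apply: (@laurentP_bounded _ _ 0).
- rewrite -(subrr N); apply: lmul_coef0 => //= n.
  by rewrite ltNge => /negPf->.
- by move=> n /=; rewrite lt_neqAle eq_sym => /andP[/negPf->].
- move=> n; have -> : lone (0 - n%:Z) = (n == 0%N)%:R by congr (_%:R); lia.
  rewrite -[X in lcoef _ (X - _)](subrr N) [LHS]lmul_coefE//; last first.
    by move=> l /=; rewrite ltNge => /negPf->.
  rewrite -(ab n); apply: eq_bigr => l _; congr (_ * _) => /=.
  by rewrite ifT; [congr b; lia|lia].
Qed.

Definition linv x : L := xget lzero [set y | lmul y x = lone].

Lemma lmulVx x : x != lzero -> lmul (linv x) x = lone.
Proof. by move=> /eqP/linv_exists; exact: xgetPex. Qed.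

Lemma linv0 : linv lzero = lzero.
Proof.
rewrite /linv xgetPN// => y /=; rewrite lmulC => h; apply: lone_neq0; rewrite -h.
by apply: laurentP => n /=; rewrite /lmul_coef fsbig1// => i _; rewrite mul0r.
Qed.

HB.instance Definition _ :=
  GRing.isZmodule.Build L laddA laddC ladd0x laddNx.
HB.instance Definition _ := GRing.Zmodule_isComNzRing.Build L
  lmulA lmulC lmul1x lmulDl (introN eqP lone_neq0).
HB.instance Definition _ := GRing.ComNzRing_isField.Build L lmulVx linv0.

End LaurentField.

(* The t^-1-adic topology: the neighbourhoods of x are the sets containing
   x + t^N k[[t^-1]] for some integer N. *)
Section LaurentTopology.
Variable k : fieldType.
Local Notation L := (laurent k).

Definition lopen (U : set L) : Prop := forall x : L, U x ->
  exists N : int, forall y : L, (forall n, N < n -> y n = x n) -> U y.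

Fact lopenT : lopen setT.
Proof. by move=> x _; exists 0. Qed.

Fact lopenI : setI_closed lopen.
Proof.
move=> U V oU oV x [/oU[N UN] /oV[M VM]].
exists (Num.min N M) => y yx.
by split; [apply: UN|apply: VM] => n h; apply: yx; rewrite gt_min h ?orbT.
Qed.

Fact lopen_bigcup (I : Type) (f : I -> set L) :
  (forall i, lopen (f i)) -> lopen (\bigcup_i f i).
Proof.
move=> fo x [i _ /fo[N fN]]; exists N => y /fN fy; by exists i.
Qed.

HB.instance Definition _ :=
  isOpenTopological.Build L lopenT lopenI lopen_bigcup.

End LaurentTopology.

Section AbsoluteValue.
Variables (R : realType) (k : finFieldType).
Implicit Type x : laurent k.

Definition ldeg x : int :=
  xget 0 [set n | x n != 0 /\ forall m, n < m -> x m = 0].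

Definition labs x : R := if x == 0 then 0 else (#|k|%:R : R) ^ ldeg x.

End AbsoluteValue.

(* k[[t^-1]] and k[t] as subsets of k((t^-1)); an element of k((t^-1)) has
   finitely many terms of nonnegative degree, so the latter are polynomials. *)
Definition lring (k : fieldType) : set (laurent k) :=
  [set x | forall n, 0 < n -> x n = 0].
Definition lpoly (k : fieldType) : set (laurent k) :=
  [set x | forall n, n < 0 -> x n = 0].

Definition GL (k : fieldType) (d : nat) : Type :=
  {g : 'M[laurent k]_d | g \in unitmx}.

HB.instance Definition _ (k : fieldType) (d : nat) :=
  Choice.copy (GL k d) {g : 'M[laurent k]_d | g \in unitmx}.
HB.instance Definition _ (k : fieldType) (d : nat) :=
  Topological.copy (GL k d)
    (initial_topology (val : {g : 'M[laurent k]_d | g \in unitmx} -> _)).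

Section GLGroup.
Variables (k : fieldType) (d : nat).
Local Notation L := (laurent k).
Implicit Types g h : GL k d.

Definition GLone : GL k d := exist _ 1%:M (unitmx1 _ _).

Fact GLmul_subproof g h : val g *m val h \in unitmx.
Proof. by rewrite unitmx_mul (valP g) (valP h). Qed.
Definition GLmul g h : GL k d := exist _ (val g *m val h) (GLmul_subproof g h).

Fact GLinv_subproof g : invmx (val g) \in unitmx.
Proof. by rewrite unitmx_inv (valP g). Qed.
Definition GLinv g : GL k d := exist _ (invmx (val g)) (GLinv_subproof g).

Fact GLmulA : associative GLmul.
Proof. by move=> f g h; apply: val_inj; rewrite /= mulmxA. Qed.
Fact GLmul1 : left_id GLone GLmul.
Proof. by move=> g; apply: val_inj; rewrite /= mul1mx. Qed.
Fact GLmulr1 : right_id GLone GLmul.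
Proof. by move=> g; apply: val_inj; rewrite /= mulmx1. Qed.
Fact GLmulV : left_inverse GLone GLinv GLmul.
Proof. by move=> g; apply: val_inj; rewrite /= mulVmx ?(valP g). Qed.
Fact GLmulrV : right_inverse GLone GLinv GLmul.
Proof. by move=> g; apply: val_inj; rewrite /= mulmxV ?(valP g). Qed.

HB.instance Definition _ := isGroup.Build (GL k d)
  GLmulA GLmul1 GLmulr1 GLmulV GLmulrV.

(* GL_d(S) for a subring S of k((t^-1)). *)
Definition GLsub (S : set L) : set (GL k d) :=
  [set g : GL k d | (forall i j, S (val g i j)) /\ (forall i j, S (val g^-1%g i j))].

Definition homothetic g h : bool :=
  `[< exists2 c : L, c != 0 & val h = c *: val g >].

Fact homothetic_refl : reflexive homothetic.
Proof. by move=> g; apply/asboolP; exists 1; rewrite ?oner_eq0 ?scale1r. Qed.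

Fact homothetic_sym : symmetric homothetic.
Proof.
suff H g h : homothetic g h -> homothetic h g.
  by move=> g h; apply/idP/idP; exact: H.
move=> /asboolP[c c0 hg]; apply/asboolP.
by exists c^-1; rewrite ?invr_eq0// hg scalerA mulVf// scale1r.
Qed.

Fact homothetic_trans : transitive homothetic.
Proof.
move=> h g f /asboolP[c c0 hg] /asboolP[b b0 fh]; apply/asboolP.
by exists (b * c); rewrite ?mulf_neq0// fh hg scalerA.
Qed.

Canonical homothetic_equiv :=
  EquivRel homothetic homothetic_refl homothetic_sym homothetic_trans.

End GLGroup.

Section PGLGroup.
Local Open Scope quotient_scope.
Variables (k : fieldType) (d : nat).

Definition PGL : Type := quotient_topology {eq_quot @homothetic_equiv k d}.

HB.instance Definition _ := Topological.copy PGL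
  (quotient_topology {eq_quot @homothetic_equiv k d}).
HB.instance Definition _ := Quotient.copy PGL
  (quotient_topology {eq_quot @homothetic_equiv k d}).

Implicit Types (x y z : PGL) (g h : GL k d).

Definition PGLone : PGL := \pi_PGL 1%g.
Definition PGLmul x y : PGL := \pi_PGL (repr x * repr y)%g.
Definition PGLinv x : PGL := \pi_PGL (repr x)^-1%g.

Fact PGL_eqP g h : \pi_PGL g = \pi_PGL h <->
  exists2 c : laurent k, c != 0 & val h = c *: val g.
Proof.
have E := @eqmodP _ (@homothetic_equiv k d) g h.
by split=> [/E/asboolP//|gh]; apply/E/asboolP.
Qed.

Fact PGL_reprP g :
  exists2 c : laurent k, c != 0 & val (repr (\pi_PGL g)) = c *: val g.
Proof. by apply/PGL_eqP; rewrite reprK. Qed.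

Fact PGLmulE g h : PGLmul (\pi_PGL g) (\pi_PGL h) = \pi_PGL (g * h)%g.
Proof.
apply/esym/PGL_eqP; have [c c0 cg] := PGL_reprP g.
have [b b0 bh] := PGL_reprP h; exists (c * b); first by rewrite mulf_neq0.
by rewrite /= cg bh -scalemxAl -scalemxAr scalerA.
Qed.

Fact PGLinvE g : PGLinv (\pi_PGL g) = \pi_PGL g^-1%g.
Proof.
apply/esym/PGL_eqP; have [c c0 cg] := PGL_reprP g.
exists c^-1; first by rewrite invr_eq0.
by rewrite /= cg invmxZ// unitmxZ ?unitfE// (valP g).
Qed.

Fact PGLmulA : associative PGLmul.
Proof.
move=> x y z; rewrite -[x]reprK -[y]reprK -[z]reprK.
rewrite (PGLmulE (repr y) (repr z)) (PGLmulE (repr x) (repr y)).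
by rewrite (PGLmulE (repr x)) (PGLmulE _ (repr z)) mulgA.
Qed.
Fact PGLmul1 : left_id PGLone PGLmul.
Proof. by move=> x; rewrite -[x]reprK [LHS]PGLmulE mul1g. Qed.
Fact PGLmulr1 : right_id PGLone PGLmul.
Proof. by move=> x; rewrite -[x]reprK [LHS]PGLmulE mulg1. Qed.
Fact PGLmulV : left_inverse PGLone PGLinv PGLmul.
Proof. by move=> x; rewrite -[x]reprK (PGLinvE (repr x)) [LHS]PGLmulE mulVg. Qed.
Fact PGLmulrV : right_inverse PGLone PGLinv PGLmul.
Proof. by move=> x; rewrite -[x]reprK (PGLinvE (repr x)) [LHS]PGLmulE mulgV. Qed.

HB.instance Definition _ := isGroup.Build PGL
  PGLmulA PGLmul1 PGLmulr1 PGLmulV PGLmulrV.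

HB.instance Definition _ := isPointed.Build PGL 1%g.

HB.instance Definition _ := Measurable.copy PGL
  (g_sigma_algebraType (@open PGL)).

(* The image of GL_d(S) in G, i.e. GL_d(S)/S^* since the scalar matrices in
   GL_d(S) are given by the units of S. *)
Definition PGLsub (S : set (laurent k)) : set PGL :=
  [set \pi_PGL g | g in GLsub S].

End PGLGroup.
Arguments PGLsub {k} d S _.

(* Gamma = PGL_d(k[t]) and K = PGL_d(k[[t^-1]]). *)
Definition PGL_poly (k : fieldType) (d : nat) : set (PGL k d) :=
  PGLsub d (@lpoly k).
Definition PGL_int (k : fieldType) (d : nat) : set (PGL k d) :=
  PGLsub d (@lring k).

Arguments PGL_poly {k} d _.
Arguments PGL_int {k} d _.

Section Subgroups.
Local Open Scope quotient_scope.
Variables (k : fieldType) (d : nat).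
Local Notation L := (laurent k).

Definition subring_set (S : set L) : Prop :=
  [/\ S 0, S 1, forall x y, S x -> S y -> S (x + y)
    & forall x y, S x -> S y -> S (x * y)].

Fact lring_subring : subring_set (@lring k).
Proof.
split=> //= [n|x y xS yS n n0|x y xS yS n n0].
- by rewrite lt_neqAle eq_sym => /andP[/negPf n0 _]; rewrite /= n0.
- by rewrite /= xS// yS// addr0.
- apply: fsbig1 => i _; have [/xS->|i0] := ltP 0 i; first by rewrite mul0r.
  by rewrite yS ?mulr0// subr_gt0 (le_lt_trans i0).
Qed.

Fact lpoly_subring : subring_set (@lpoly k).
Proof.
split=> //= [n|x y xS yS n n0|x y xS yS n n0].
- by rewrite lt_neqAle => /andP[/negPf n0 _]; rewrite /= n0.
- by rewrite /= xS// yS// addr0.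
- apply: fsbig1 => i _; have [/xS->|i0] := ltP i 0; first by rewrite mul0r.
  by rewrite yS ?mulr0// subr_lt0 (lt_le_trans n0).
Qed.

Lemma PGLsub1 (S : set L) : subring_set S -> PGLsub d S 1%g.
Proof.
move=> [S0 S1 _ _]; exists 1%g => //.
have H (i j : 'I_d) : S ((1%:M : 'M[L]_d) i j).
  by rewrite mxE; case: (i == j).
by split=> i j; rewrite ?invg1; exact: H.
Qed.

Lemma PGLsubM (S : set L) (x y : PGL k d) : subring_set S ->
  PGLsub d S x -> PGLsub d S y -> PGLsub d S (x * y)%g.
Proof.
move=> [S0 S1 SD SM] [g [gS gS'] <-] [h [hS hS'] <-].
have H (a b : 'M[L]_d) : (forall i j, S (a i j)) -> (forall i j, S (b i j)) ->
    forall i j, S ((a *m b) i j).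
  move=> aS bS i j; rewrite mxE; elim/big_ind : _ => // l _; exact: SM.
exists (g * h)%g; last by rewrite -PGLmulE.
by split; [exact: H|rewrite invgM; exact: H].
Qed.

Lemma PGLsubV (S : set L) (x : PGL k d) :
  PGLsub d S x -> PGLsub d S x^-1%g.
Proof.
move=> [g [gS gS'] <-]; exists g^-1%g; last by rewrite -PGLinvE.
by split=> //; rewrite invgK.
Qed.

Implicit Types x y z : PGL k d.

Definition lcoset_rel x y : bool :=
  `[< exists2 c, PGL_poly d c & y = (c * x)%g >].

Fact lcoset_refl : reflexive lcoset_rel.
Proof.
move=> x; apply/asboolP; exists 1%g; rewrite ?mul1g//.
exact: PGLsub1 lpoly_subring.
Qed.

Fact lcoset_sym : symmetric lcoset_rel.
Proof.
suff H x y : lcoset_rel x y -> lcoset_rel y x.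
  by move=> x y; apply/idP/idP; exact: H.
move=> /asboolP[c cG ->]; apply/asboolP; exists c^-1%g; rewrite ?mulKg//.
exact: PGLsubV.
Qed.

Fact lcoset_trans : transitive lcoset_rel.
Proof.
move=> y x z /asboolP[c cG ->] /asboolP[b bG ->]; apply/asboolP.
by exists (b * c)%g; rewrite ?mulgA//; exact: PGLsubM lpoly_subring _ _.
Qed.

Canonical lcoset_equiv :=
  EquivRel lcoset_rel lcoset_refl lcoset_sym lcoset_trans.

Definition dcoset_rel x y : bool :=
  `[< exists c h, [/\ PGL_poly d c, PGL_int d h & y = (c * x * h)%g] >].

Fact dcoset_refl : reflexive dcoset_rel.
Proof.
move=> x; apply/asboolP; exists 1%g, 1%g; rewrite mul1g mulg1; split=> //.
- exact: PGLsub1 lpoly_subring.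
- exact: PGLsub1 lring_subring.
Qed.

Fact dcoset_sym : symmetric dcoset_rel.
Proof.
suff H x y : dcoset_rel x y -> dcoset_rel y x.
  by move=> x y; apply/idP/idP; exact: H.
move=> /asboolP[c [h [cG hK ->]]]; apply/asboolP; exists c^-1%g, h^-1%g.
by split; [exact: PGLsubV|exact: PGLsubV|rewrite !mulgA mulVg mul1g mulgK].
Qed.

Fact dcoset_trans : transitive dcoset_rel.
Proof.
move=> y x z /asboolP[c [h [cG hK ->]]] /asboolP[b [l [bG lK ->]]].
apply/asboolP; exists (b * c)%g, (h * l)%g; split; last by rewrite !mulgA.
- exact: PGLsubM lpoly_subring _ _.
- exact: PGLsubM lring_subring _ _.
Qed.

Canonical dcoset_equiv :=
  EquivRel dcoset_rel dcoset_refl dcoset_sym dcoset_trans.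

End Subgroups.

(* Gamma being discrete, the quotient of the Borel sigma-algebra of G is the
   Borel sigma-algebra of Gamma\G. *)
Section GammaG.
Local Open Scope quotient_scope.
Variables (k : fieldType) (d : nat).

Definition GammaG : Type := {eq_quot @lcoset_equiv k d}.
HB.instance Definition _ := Quotient.copy GammaG {eq_quot @lcoset_equiv k d}.
HB.instance Definition _ := Choice.copy GammaG {eq_quot @lcoset_equiv k d}.
HB.instance Definition _ := isPointed.Build GammaG (\pi_GammaG 1%g).

Definition GammaG_measurable : set (set GammaG) :=
  [set A | measurable (\pi_GammaG @^-1` A)].

Fact GammaG_measurable0 : GammaG_measurable set0.
Proof. by rewrite /GammaG_measurable /= preimage_set0. Qed.
Fact GammaG_measurableC A : GammaG_measurable A -> GammaG_measurable (~` A).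
Proof. by rewrite /GammaG_measurable /= preimage_setC; exact: measurableC. Qed.
Fact GammaG_measurable_bigcup (A : (set GammaG)^nat) :
  (forall i, GammaG_measurable (A i)) -> GammaG_measurable (\bigcup_i A i).
Proof.
move=> mA; rewrite /GammaG_measurable /= preimage_bigcup.
by apply: bigcup_measurable => i _; exact: mA.
Qed.

Definition GammaG_display : measure_display. Proof. exact. Qed.
HB.instance Definition _ := isMeasurable.Build GammaG_display GammaG
  GammaG_measurable0 GammaG_measurableC GammaG_measurable_bigcup.

End GammaG.

(* Y = Gamma\G/K. Its double cosets are open in G, so the quotient
   sigma-algebra contains every subset of Y. *)
Section DoubleCosets.
Local Open Scope quotient_scope.
Variables (k : fieldType) (d : nat).

Definition Ydc : Type := {eq_quot @dcoset_equiv k d}.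
HB.instance Definition _ := Quotient.copy Ydc {eq_quot @dcoset_equiv k d}.
HB.instance Definition _ := Choice.copy Ydc {eq_quot @dcoset_equiv k d}.
HB.instance Definition _ := isPointed.Build Ydc (\pi_Ydc 1%g).

Definition Ydc_measurable : set (set Ydc) :=
  [set A | measurable (\pi_Ydc @^-1` A)].

Fact Ydc_measurable0 : Ydc_measurable set0.
Proof. by rewrite /Ydc_measurable /= preimage_set0. Qed.
Fact Ydc_measurableC A : Ydc_measurable A -> Ydc_measurable (~` A).
Proof. by rewrite /Ydc_measurable /= preimage_setC; exact: measurableC. Qed.
Fact Ydc_measurable_bigcup (A : (set Ydc)^nat) :
  (forall i, Ydc_measurable (A i)) -> Ydc_measurable (\bigcup_i A i).
Proof.
move=> mA; rewrite /Ydc_measurable /= preimage_bigcup.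
by apply: bigcup_measurable => i _; exact: mA.
Qed.

Definition Ydc_display : measure_display. Proof. exact. Qed.
HB.instance Definition _ := isMeasurable.Build Ydc_display Ydc
  Ydc_measurable0 Ydc_measurableC Ydc_measurable_bigcup.

Definition projY (x : GammaG k d) : Ydc := \pi_Ydc (repr x).

Lemma projYE (x : PGL k d) : projY (\pi_(GammaG k d) x) = \pi_Ydc x.
Proof.
apply/(@eqmodP _ (@dcoset_equiv k d)); apply/asboolP.
have /(@eqmodP _ (@lcoset_equiv k d))/asboolP[c cG xE] :
  \pi_(GammaG k d) (repr (\pi_(GammaG k d) x)) = \pi_(GammaG k d) x.
  by rewrite reprK.
exists c, 1%g; rewrite mulg1; split=> //.
exact: PGLsub1 (lring_subring k).
Qed.

Lemma measurable_projY : measurable_fun setT projY.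
Proof.
move=> _ A mA; rewrite setTI.
rewrite /measurable /= /GammaG_measurable /=.
rewrite [X in measurable X](_ : _ = \pi_Ydc @^-1` A)//.
by apply/seteqP; split => x /=; rewrite projYE.
Qed.

End DoubleCosets.

Section Measures.
Local Open Scope ereal_scope.
Local Open Scope quotient_scope.
Variables (R : realType) (k : fieldType) (d : nat).
Local Notation G := (PGL k d).
Implicit Types (vol : {measure set G -> \bar R}).
Implicit Types (m : {measure set (GammaG k d) -> \bar R}).

(* Regularity is automatic, G being locally compact and second countable. *)
Definition is_haar vol : Prop :=
  [/\ vol setT != 0, forall C, compact C -> vol C < +oo
    & forall (g : G) (A : set G), measurable A ->
        vol [set (g * x)%g | x in A] = vol A].

(* m is the quotient of vol by the counting measure on Gamma. *)
Definition is_quotient_measure vol m : Prop :=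
  forall f : G -> \bar R, measurable_fun setT f -> (forall x, 0 <= f x) ->
    \int[vol]_x f x =
    \int[m]_x \esum_(c in PGL_poly d) f (c * repr x)%g.

Definition nuY m : set (Ydc k d) -> \bar R := pushforward m (@projY k d).

Fact nuY0 m : nuY m set0 = 0.
Proof. by rewrite /nuY /pushforward preimage_set0 measure0. Qed.
Fact nuY_ge0 m A : 0 <= nuY m A.
Proof. by rewrite /nuY /pushforward measure_ge0. Qed.
Fact nuY_sigma_additive m : semi_sigma_additive (nuY m).
Proof.
move=> F mF tF mUF; have mp := @measurable_projY k d.
rewrite /nuY /pushforward preimage_bigcup; apply: measure_semi_sigma_additive.
- by move=> n; rewrite -[X in measurable X]setTI; exact: mp.
- apply/trivIsetP => /= i j _ _ ij; rewrite -preimage_setI.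
  by move/trivIsetP : tF => /(_ _ _ _ _ ij) ->//; rewrite preimage_set0.
- by rewrite -preimage_bigcup -[X in measurable X]setTI; exact: mp.
Qed.
HB.instance Definition _ m := isMeasure.Build _ _ _ (nuY m)
  (nuY0 m) (nuY_ge0 m) (@nuY_sigma_additive m).

Fact nuY_total_inv_ge0 m : (0 <= (fine (nuY m setT))^-1)%R.
Proof. by rewrite invr_ge0 fine_ge0. Qed.

Definition muY m : {measure set (Ydc k d) -> \bar R} :=
  mscale (NngNum (nuY_total_inv_ge0 m)) (nuY m).

End Measures.

Section Height.
Local Open Scope quotient_scope.
Variables (R : realType) (k : finFieldType) (d : nat).
Local Notation L := (laurent k).
Local Notation abs := (@labs R k).
Implicit Types g : GL k d.

(* g Lambda_0, where Lambda_0 = k[t]^d is the standard lattice. *)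
Definition lattice g : set 'cV[L]_d :=
  [set val g *m v | v in [set v : 'cV[L]_d | forall i, lpoly (v i 0)]].

Definition covol g : R := abs (\det (val g)).

(* The coordinates of v_1 /\ ... /\ v_j in the standard basis (e_I) of the
   exterior power, indexed by the increasing maps I : [j] -> [d], are the
   minors of (v_1, ..., v_j) on the rows in I. *)
Definition wedge_coord (j : nat) (v : j.-tuple 'cV[L]_d)
    (I : {ffun 'I_j -> 'I_d}) : L :=
  \det (\matrix_(a < j, b < j) tnth v b (I a) 0).

Definition wedge_norm (j : nat) (v : j.-tuple 'cV[L]_d) : R :=
  \big[Num.max/0]_(I : {ffun 'I_j -> 'I_d} |
      [forall a : 'I_j, forall b : 'I_j, (a < b)%N ==> (I a < I b)%N])
    abs (wedge_coord v I).

(* alpha([g Lambda_0]); the supremum is a maximum. *)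
Definition alpha_lattice g : \bar R :=
  ereal_sup [set y | exists (j : nat) (v : j.-tuple 'cV[L]_d),
    [/\ (1 <= j <= d)%N, forall i, lattice g (tnth v i), free v
      & y = ((covol g `^ (j%:R / d%:R)) * (wedge_norm v)^-1)%:E]].

Definition alpha (y : Ydc k d) : \bar R :=
  alpha_lattice (repr (repr y))^-1%g.

End Height.

(* Main.v *)
(* By row reduction over F_q[t], every double coset in Y has a representative
   t^a = diag(t^(a_1), ..., t^(a_d)) with min a = 0; this is Grothendieck's
   splitting theorem for the rank d bundles on P^1, up to twist. Put
   h(a) = \sum_(i, j) max(a_i - a_j, 0). The stabilizer Gamma /\ t^a K t^-a
   consists of matrices whose (i, j) entry is a polynomial of degree at most
   a_i - a_j, so its order, the inverse of the mass of the point, is q^h(a) up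
   to a factor between 1 and q^(d^2). On the other hand the height of the point
   is at most q^(h(a)/d): a j x j minor of the lattice vectors that does not
   vanish involves j distinct exponents a_f(i), and
   d \sum_i a_f(i) - j \sum_l a_l <= h(a). Hence for r < d the integral is
   dominated by \sum_a q^(-(1 - r/d) h(a)), which is bounded by a product of
   geometric series because h(a) >= \sum_i a_i when min a = 0. For
   a = (n, 0, ..., 0) the height is exactly q^(h(a)/d), so for r >= d each of
   these infinitely many points contributes at least q^(-d^2). *)
Require Import Defs.
From HB Require Import structures.
From mathcomp Require Import all_boot all_order all_algebra.
From mathcomp Require Import all_classical all_reals all_analysis.
From mathcomp Require Import measurable_realfun.
From mathcomp Require Import perm zify ring.

Set Implicit Arguments.
Unset Strict Implicit.

Import Order.TTheory GRing.Theory Num.Theory.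

Local Open Scope classical_set_scope.
Local Open Scope ring_scope.

(** * Degrees in k((t^-1)) *)

Section LaurentDegree.
Variable k : fieldType.
Implicit Types (x y : laurent k) (N M : int).

(* deg x <= N, with deg the degree in t *)
Definition dle x N := forall n, N < n -> x n = 0.

Lemma dle0 N : dle 0 N. Proof. by []. Qed.

Lemma dle_trans N M x : dle x N -> N <= M -> dle x M.
Proof. by move=> xN NM n Mn; rewrite xN// (le_lt_trans NM). Qed.

Lemma dleD x y N : dle x N -> dle y N -> dle (x + y) N.
Proof.
by move=> xN yN n Nn; rewrite [LHS](_ : _ = x n + y n)// xN// yN// addr0.
Qed.

Lemma dleN x N : dle x N -> dle (- x) N.
Proof. by move=> xN n Nn; rewrite [LHS](_ : _ = - x n)// xN// oppr0. Qed.

Lemma dleM x y N M : dle x N -> dle y M -> dle (x * y) (N + M).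
Proof. by move=> xN yM; exact: lmul_coef0. Qed.

Lemma dle_sum (I : Type) (r : seq I) (P : pred I) (F : I -> laurent k) N :
  (forall i, P i -> dle (F i) N) -> dle (\sum_(i <- r | P i) F i) N.
Proof. by move=> FN; elim/big_ind : _ => // *; exact: dleD. Qed.

Lemma dle1 : dle 1 0.
Proof.
by move=> n; rewrite lt_neqAle eq_sym => /andP[/negPf n0 _]; rewrite [LHS]/= n0.
Qed.

Lemma dle_prod (I : Type) (r : seq I) (P : pred I) (F : I -> laurent k)
    (N : I -> int) :
  (forall i, P i -> dle (F i) (N i)) ->
  dle (\prod_(i <- r | P i) F i) (\sum_(i <- r | P i) N i).
Proof.
move=> FN; elim/big_ind2 : _ => //; first exact: dle1.
by move=> *; exact: dleM.
Qed.

Lemma dle_pred x N : dle x N -> x N = 0 -> dle x (N - 1).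
Proof.
by move=> xN x0 n Nn; have [/xN//|nN] := ltP N n; rewrite (_ : n = N)//; lia.
Qed.

Lemma dle_sign (b : bool) x N : dle x N -> dle ((-1) ^+ b * x) N.
Proof. by case: b => xN; rewrite ?mulN1r ?mul1r//; exact: dleN. Qed.

(** Every term of the Leibniz expansion takes one entry from each row. *)
Lemma dle_det n (A : 'M[laurent k]_n) (a : 'I_n -> int) :
  (forall i j, dle (A i j) (a i)) -> dle (\det A) (\sum_i a i).
Proof.
move=> Aa; apply: dle_sum => s _; apply: dle_sign.
exact: (@dle_prod _ _ _ _ a).
Qed.

Lemma coef_sum (I : Type) (r : seq I) (P : pred I) (F : I -> laurent k) n :
  (\sum_(i <- r | P i) F i) n = \sum_(i <- r | P i) F i n.
Proof. by apply: (big_morph (fun x : laurent k => x n)). Qed.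

Lemma coefM_lead x y N M : dle x N -> dle y M -> (x * y) (N + M) = x N * y M.
Proof.
move=> xN yM; have := lmul_coefE xN yM 0.
by rewrite subr0 big_ord_recl big_ord0 addr0/= !subr0 => <-.
Qed.

Lemma leadP x : x != 0 -> exists2 N, x N != 0 & dle x N.
Proof.
move=> x0; have [M xM] := lbounded x.
have [j xj] : exists j : nat, x (M - j%:Z) != 0.
  apply: contrapT => /forallNP x00; move/eqP: x0; apply.
  apply: (laurentP_bounded xM) => // j.
  by apply/eqP; apply: contra_notT (x00 j).
have [i xi imin] := ex_minnP (ex_intro (fun j : nat => x (M - j%:Z) != 0) j xj).
exists (M - i%:Z) => // n Nn; have [/xM//|nM] := ltP M n.
apply/eqP; apply: contraT => xn.
have := imin `|M - n|%N; rewrite (_ : M - _ = n); last by lia.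
by move=> /(_ xn); lia.
Qed.

Lemma lring_dle x : lring x <-> dle x 0. Proof. by []. Qed.

(* c t^N *)
Fact lterm_bounded (c : k) N :
  exists M, forall n, M < n -> (if n == N then c else 0) = 0.
Proof. by exists N => n; rewrite lt_neqAle eq_sym => /andP[/negPf->]. Qed.
Definition lterm c N : laurent k := Laurent (lterm_bounded c N).

Lemma dle_lterm c N : dle (lterm c N) N.
Proof. by move=> n; rewrite lt_neqAle eq_sym /= => /andP[/negPf->]. Qed.

Lemma ltermMl c N x n : (lterm c N * x) n = c * x (n - N).
Proof.
rewrite [LHS]/= /lmul_coef -(@fsbig_widen _ _ _ _ [set N] setT)//.
  by rewrite fsbig_set1 /= eqxx.
by move=> i [_ /= /eqP /negPf->]; rewrite mul0r.
Qed.

Lemma lterm0 N : lterm 0 N = 0.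
Proof. by apply: laurentP => n /=; case: ifP. Qed.

Lemma lpoly_lterm c N : 0 <= N -> lpoly (lterm c N).
Proof. by move=> N0 n n0 /=; case: eqP => // nN; lia. Qed.

Definition lmon := lterm 1.

Lemma dle_lmon N : dle (lmon N) N. Proof. exact: dle_lterm. Qed.

Lemma lmonMl N x n : (lmon N * x) n = x (n - N).
Proof. by rewrite ltermMl mul1r. Qed.

Lemma lmonD N M : lmon (N + M) = lmon N * lmon M.
Proof. by apply: laurentP => n; rewrite lmonMl /= subr_eq [M + N]addrC. Qed.

Lemma lmon0 : lmon 0 = 1.
Proof. by apply: laurentP => n /=; case: eqP. Qed.

Lemma lmon_neq0 N : lmon N != 0.
Proof.
apply/eqP => /(congr1 (fun x : laurent k => x N)) /eqP.
by rewrite /= eqxx oner_eq0.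
Qed.

Lemma lmon_prod (I : Type) (r : seq I) (P : pred I) (N : I -> int) :
  \prod_(i <- r | P i) lmon (N i) = lmon (\sum_(i <- r | P i) N i).
Proof. by rewrite (big_morph lmon lmonD lmon0). Qed.

Lemma lpolyN x : lpoly x -> lpoly (- x).
Proof. by move=> px n n0; rewrite [LHS](_ : _ = - x n)// px// oppr0. Qed.

End LaurentDegree.

(** * The absolute value of k((t^-1)) for a finite field k *)

Section LaurentAbs.
Variable k : finFieldType.
Implicit Types (x y : laurent k) (N M : int).

Lemma ldegP x : x != 0 -> x (ldeg x) != 0 /\ dle x (ldeg x).
Proof.
move=> /leadP[N xN xdN].
have : [set n | x n != 0 /\ dle x n] (ldeg x) by apply: xgetPex; exists N.
by [].
Qed.

Lemma ldeg_le x N : x != 0 -> dle x N <-> ldeg x <= N.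
Proof.
move=> /ldegP[x0 xd]; split=> [xN|]; last exact: dle_trans.
by rewrite leNgt; apply/negP => /xN /eqP; exact/negP.
Qed.

Lemma ldeg_eq x N : x N != 0 -> dle x N -> ldeg x = N.
Proof.
move=> xN dN; have x0 : x != 0 by apply: contraNneq xN => ->.
apply/eqP; rewrite eq_le; apply/andP; split; first exact/ldeg_le.
by rewrite leNgt; apply/negP => /(ldegP x0).2 /eqP; exact/negP.
Qed.

Lemma ldegM x y : x != 0 -> y != 0 -> ldeg (x * y) = ldeg x + ldeg y.
Proof.
move=> /ldegP[x0 xd] /ldegP[y0 yd]; apply: ldeg_eq; last exact: dleM.
by rewrite coefM_lead// mulf_neq0.
Qed.

Lemma ldeg1 : ldeg (1 : laurent k) = 0.
Proof. by apply: ldeg_eq; [rewrite /= oner_eq0|exact: dle1]. Qed.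

Lemma lpoly_ldeg_ge0 x : lpoly x -> x != 0 -> 0 <= ldeg x.
Proof.
by move=> px /ldegP[x0 _]; rewrite leNgt; apply: contra_neqN x0 => /px.
Qed.

Lemma ldeg_lmon N : ldeg (lmon k N) = N.
Proof. by apply: ldeg_eq; [rewrite /= eqxx oner_eq0|exact: dle_lmon]. Qed.


Variable R : realType.
Local Notation abs := (@labs R k).
Local Notation q := (#|k|%:R : R).

Lemma q_gt1 : 1 < q. Proof. by rewrite ltr1n card_finNzRing_gt1. Qed.
Lemma q_gt0 : 0 < q. Proof. exact: lt_trans q_gt1. Qed.
Hint Resolve q_gt0 q_gt1 : core.

Lemma absE x : x != 0 -> abs x = q ^ ldeg x.
Proof. by rewrite /labs => /negPf->. Qed.

Lemma abs0 : abs 0 = 0. Proof. by rewrite /labs eqxx. Qed.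

Lemma abs_gt0 x : x != 0 -> 0 < abs x.
Proof. by move=> x0; rewrite absE// exprz_gt0. Qed.

Lemma abs_ge0 x : 0 <= abs x.
Proof. by have [->|/abs_gt0/ltW//] := eqVneq x 0; rewrite abs0. Qed.

Lemma absM x y : abs (x * y) = abs x * abs y.
Proof.
have [->|x0] := eqVneq x 0; first by rewrite mul0r abs0 mul0r.
have [->|y0] := eqVneq y 0; first by rewrite mulr0 abs0 mulr0.
by rewrite !absE ?mulf_neq0// ldegM// expfzDr// gt_eqF.
Qed.

Lemma abs1 : abs 1 = 1.
Proof. by rewrite absE ?oner_eq0// ldeg1 expr0z. Qed.

Lemma absX x n : abs (x ^+ n) = abs x ^+ n.
Proof. by elim: n => [|n IH]; rewrite ?expr0 ?abs1// !exprS absM IH. Qed.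

Lemma abs_lmon N : abs (lmon k N) = q ^ N.
Proof. by rewrite absE ?lmon_neq0// ldeg_lmon. Qed.

Lemma abs_le x N : abs x <= q ^ N <-> dle x N.
Proof.
have [->|x0] := eqVneq x 0.
  by rewrite abs0; split=> // _; rewrite exprz_ge0.
by rewrite absE// ler_eXz2l//; split=> [/(ldeg_le _ x0)|/(ldeg_le _ x0)].
Qed.

Lemma abs_le_ring x y N : dle x N -> abs (x * y) <= q ^ N * abs y.
Proof. by move=> /abs_le xN; rewrite absM ler_wpM2r// abs_ge0. Qed.

(** The ultrametric inequality. The bound B is any nonnegative real, so two nonzero terms are
    compared through N, the larger of their degrees, for which q^N <= B. *)
Lemma abs_sum_le (I : Type) (r : seq I) (P : pred I) (F : I -> laurent k)
    (B : R) : 0 <= B ->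
  (forall i, P i -> abs (F i) <= B) -> abs (\sum_(i <- r | P i) F i) <= B.
Proof.
move=> B0 FB; elim/big_ind : _ => //; first by rewrite abs0.
move=> x y xB yB; have [->|x0] := eqVneq x 0; first by rewrite add0r.
have [->|y0] := eqVneq y 0; first by rewrite addr0.
have {B0 FB} [N [xN yN NB]] : exists N, [/\ dle x N, dle y N & q ^ N <= B].
  have [xy|yx] := leP (ldeg x) (ldeg y).
  - by exists (ldeg y); split; rewrite ?(ldeg_le _ x0) ?(ldeg_le _ y0)// -absE.
  - exists (ldeg x); split; rewrite ?(ldeg_le _ x0) ?(ldeg_le _ y0)// -?absE//.
    exact: ltW.
by apply: le_trans NB; apply/abs_le; exact: dleD.
Qed.

(** A nonzero polynomial has nonnegative degree. This discreteness of k[t] bounds minors of lattice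
    vectors from below. *)
Lemma lpoly_abs_ge1 x : lpoly x -> x != 0 -> 1 <= abs x.
Proof.
move=> px x0; rewrite absE// -(expr0z q) ler_eXz2l//.
exact: lpoly_ldeg_ge0.
Qed.

End LaurentAbs.

(** * Matrices over subrings and row reduction *)

Section SubringMatrices.
Variables (k : fieldType) (S : set (laurent k)).
Hypotheses (hS : subring_set S) (hN : forall x, S x -> S (- x)).

Lemma subring_det n (A : 'M[laurent k]_n) :
  (forall i j, S (A i j)) -> S (\det A).
Proof.
have [S0 S1 SD SM] := hS; move=> SA; apply: (big_ind S) => // s _.
have Sprod : S (\prod_i A i (s i)) by exact: (big_ind S).
by case: (odd_perm s); rewrite ?mulN1r ?mul1r//; exact: hN.
Qed.

(** Cramer's rule: up to sign, the entries of the adjugate are minors. *)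
Lemma subring_invmx n (A : 'M[laurent k]_n) : A \in unitmx ->
  (forall i j, S (A i j)) -> S (\det A)^-1 -> forall i j, S (invmx A i j).
Proof.
have [S0 S1 SD SM] := hS; move=> uA SA Sd i j.
rewrite /invmx uA mxE; apply: SM => //; rewrite mxE /cofactor.
have /= := @subring_det _ (row' j (col' i A)) _.
rewrite -signr_odd; case: odd; rewrite ?mulN1r ?mul1r => Sdet; last first.
  by apply: Sdet => a b; rewrite !mxE.
by apply: hN; apply: Sdet => a b; rewrite !mxE.
Qed.

End SubringMatrices.

(** * Diagonal representatives of the double cosets *)

Section ReductionTheory.
Variable k : finFieldType.
Local Notation L := (laurent k).

Lemma lringN (x : L) : lring x -> lring (- x).
Proof. exact: (@dleN _ x 0). Qed.

Lemma dle_matrix_bound m n (A : 'M[L]_(m, n)) :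
  exists N : nat, forall i j, dle (A i j) N%:Z.
Proof.
have [f fP] := choice (fun ij : 'I_m * 'I_n => lbounded (A ij.1 ij.2)).
exists (\max_ij `|f ij|)%N => i j.
apply: (@dle_trans _ (f (i, j))); first exact: (fP (i, j)).
apply: (@le_trans _ _ `|f (i, j)|%N%:Z); first by rewrite lez_abs.
by rewrite lez_nat (leq_bigmax (i, j)).
Qed.

(* If a coefficient of t^(N+1) occurred in A^-1, reading A A^-1 = 1 at t^(N+1)
   would put a nonzero column in the kernel of the reduction of A. *)
Lemma lring_invmx n (A : 'M[L]_n) : A \in unitmx ->
  (forall i j, lring (A i j)) -> (\matrix_(i, j) A i j 0) \in unitmx ->
  forall i j, lring (invmx A i j).
Proof.
move=> uA SA uA0.
have [N] := dle_matrix_bound (invmx A); elim: N => [//|N IH HN]; apply: IH.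
pose B : 'M[k]_n := \matrix_(i, j) invmx A i j N.+1%:Z.
have B0 : B = 0.
  rewrite -[B](mulKmx uA0) (_ : _ *m B = 0) ?mulmx0//.
  apply/matrixP => i j; have /matrixP /(_ i j) := mulmxV uA.
  rewrite !mxE => /(congr1 (fun x : L => x N.+1%:Z)).
  rewrite coef_sum [X in _ = X](_ : _ = 0); last by case: (i == j).
  move=> AB0; rewrite -[RHS]AB0; apply: eq_bigr => l _; rewrite !mxE.
  rewrite -[in RHS](add0r N.+1%:Z).
  by rewrite coefM_lead// => ? ?; exact: SA.
move=> i j; rewrite (_ : N%:Z = N.+1%:Z - 1); last by lia.
by apply: dle_pred => //; move/matrixP : B0 => /(_ i j); rewrite !mxE.
Qed.

Lemma ldegV_eq0 (x : L) : x != 0 -> 0 <= ldeg x -> 0 <= ldeg x^-1 -> ldeg x = 0.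
Proof.
move=> x0; have := ldegM x0 (invr_neq0 x0).
by rewrite divff// ldeg1 => /esym/eqP; rewrite addr_eq0 => /eqP ->; lia.
Qed.

Variable d : nat.
Implicit Types g h c : GL k d.

Lemma det_GL_neq0 g : \det (val g) != 0.
Proof. by have := valP g; rewrite unitmxE unitfE. Qed.

Lemma det_GLM g h : \det (val (g * h)%g) = \det (val g) * \det (val h).
Proof. exact: det_mulmx. Qed.

Lemma ldeg_detM g h :
  ldeg (\det (val (g * h)%g)) = ldeg (\det (val g)) + ldeg (\det (val h)).
Proof. by rewrite det_GLM ldegM ?det_GL_neq0. Qed.

Lemma det_GLV g : \det (val g^-1%g) = (\det (val g))^-1.
Proof. by rewrite [val g^-1%g]/= det_inv. Qed.

(** The determinant and its inverse are both polynomials, so neither has negative degree. *)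
Lemma ldeg_det_poly c : GLsub (@lpoly k) c -> ldeg (\det (val c)) = 0.
Proof.
have sub := subring_det (lpoly_subring k) (@lpolyN k).
move=> [/sub pc /sub]; rewrite det_GLV => pcV; apply: ldegV_eq0.
- exact: det_GL_neq0.
- by apply: lpoly_ldeg_ge0 => //; exact: det_GL_neq0.
- by apply: lpoly_ldeg_ge0 => //; rewrite invr_neq0// det_GL_neq0.
Qed.

Lemma ldeg_det_ring h : GLsub (@lring k) h -> ldeg (\det (val h)) = 0.
Proof.
have sub := subring_det (lring_subring k) lringN.
move=> [/sub/lring_dle rh /sub/lring_dle]; rewrite det_GLV => rhV.
have h0 := det_GL_neq0 h; rewrite -[RHS]oppr0; apply/esym/eqP.
have := ldegM h0 (invr_neq0 h0); rewrite divff// ldeg1.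
move: rh rhV => /(ldeg_le _ h0) rh /(ldeg_le _ (invr_neq0 h0)) rhV.
by move=> e; apply/eqP; lia.
Qed.

Fact tdiag_subproof (a : 'I_d -> int) :
  diag_mx (\row_i lmon k (a i)) \in unitmx.
Proof.
rewrite unitmxE unitfE det_diag; apply/prodf_neq0 => i _.
by rewrite mxE lmon_neq0.
Qed.
Definition tdiag a : GL k d :=
  exist (fun g : 'M[L]_d => g \in unitmx) _ (tdiag_subproof a).

Lemma tdiagMl a m (A : 'M[L]_(d, m)) i j :
  (val (tdiag a) *m A) i j = lmon k (a i) * A i j.
Proof. by rewrite mul_diag_mx !mxE. Qed.

Lemma tdiagMr a m (A : 'M[L]_(m, d)) i j :
  (A *m val (tdiag a)) i j = A i j * lmon k (a j).
Proof. by rewrite mul_mx_diag !mxE. Qed.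

Lemma det_tdiag a : \det (val (tdiag a)) = lmon k (\sum_i a i).
Proof.
by rewrite det_diag -lmon_prod; apply: eq_bigr => i _; rewrite mxE.
Qed.

Lemma tdiagD a b : tdiag (a \+ b) = (tdiag a * tdiag b)%g.
Proof.
apply: val_inj => /=; rewrite mulmx_diag; congr diag_mx.
by apply/rowP => i; rewrite !mxE lmonD.
Qed.

Lemma tdiag0 a : (forall i, a i = 0) -> tdiag a = 1%g.
Proof.
move=> a0; apply: val_inj => /=; rewrite -diag_const_mx; congr diag_mx.
by apply/rowP => i; rewrite !mxE a0 lmon0.
Qed.

Lemma tdiagN a : tdiag (\- a) = (tdiag a)^-1%g.
Proof.
apply: (mulgI (tdiag a)); rewrite -tdiagD mulgV; apply: tdiag0 => i.
by rewrite /= subrr.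
Qed.

Lemma GLsub_poly1 : GLsub (@lpoly k) (1%g : GL k d).
Proof.
have [S0 S1 _ _] := lpoly_subring k.
have H (i j : 'I_d) : lpoly ((1%:M : 'M[L]_d) i j) by rewrite mxE; case: (i == j).
by split=> i j; rewrite ?invg1; exact: H.
Qed.

Lemma GLsubM (S : set L) g h : subring_set S ->
  GLsub S g -> GLsub S h -> GLsub S (g * h)%g.
Proof.
move=> [S0 S1 SD SM] [gS gS'] [hS hS'].
have H (a b : 'M[L]_d) : (forall i j, S (a i j)) -> (forall i j, S (b i j)) ->
    forall i j, S ((a *m b) i j).
  move=> aS bS i j; rewrite mxE; apply: (big_ind S) => // l _; exact: SM.
by split; [exact: H|rewrite invgM; exact: H].
Qed.

Lemma GLsubV (S : set L) g : GLsub S g -> GLsub S g^-1%g.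
Proof. by move=> [gS gS']; split=> //; rewrite invgK. Qed.

(** With N = e_i0 u, the vanishing of u at i0 gives N^2 = 0, so 1 - N is a polynomial inverse of 1 +
    N. *)
Lemma transvection_poly (i0 : 'I_d) (u : 'rV[L]_d) :
  u 0 i0 = 0 -> (forall j, lpoly (u 0 j)) ->
  exists2 c : GL k d, GLsub (@lpoly k) c &
    val c = 1%:M + delta_mx i0 (0 : 'I_1) *m u.
Proof.
move=> u0 pu; pose N : 'M[L]_d := delta_mx i0 (0 : 'I_1) *m u.
have NN : N *m N = 0.
  rewrite /N -mulmxA (mulmxA u) (_ : u *m _ = 0) ?mul0mx ?mulmx0//.
  apply/matrixP => i j; rewrite !mxE !ord1 (bigD1 i0)//= u0 mul0r add0r big1// => l.
  by move=> /negPf li; rewrite mxE li mulr0.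
have NV : (1%:M + N) *m (1%:M - N) = 1%:M.
  by rewrite mulmxDl !mulmxBr !mul1mx mulmx1 NN subr0 subrK.
have uN := (mulmx1_unit NV).1.
have pE (s : L) : lpoly s -> forall i j, lpoly ((1%:M + s *: N) i j).
  have [S0 S1 SD SM] := lpoly_subring k.
  move=> ps i j; rewrite !mxE; apply: SD; first by case: (i == j).
  by apply: (SM) => //; rewrite big_ord1 !mxE; apply: SM => //; case: (_ && _).
have [_ S1 _ _] := lpoly_subring k.
exists (exist (fun g : 'M[L]_d => g \in unitmx) _ uN) => //; split=> i j /=.
  by rewrite -[N]scale1r; exact: pE.
rewrite (_ : invmx _ = 1%:M + -1 *: N); first by apply: pE; exact: lpolyN.
by rewrite scaleN1r -[RHS](mulKmx uN) NV mulmx1.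
Qed.

(* If the leading coefficients of the rows are dependent, a polynomial
   transvection lowers the degree of a row of maximal degree among those
   involved. *)
Lemma row_reduction_step g (a : 'I_d -> int) :
  (forall i j, dle (val g i j) (a i)) ->
  (\matrix_(i, j) val g i j (a i)) \notin unitmx ->
  exists c (b : 'I_d -> int), [/\ GLsub (@lpoly k) c,
    forall i j, dle (val (c * g)%g i j) (b i) & \sum_i b i = \sum_i a i - 1].
Proof.
move=> ga; set M := \matrix_(i, j) _ => nuM.
have /det0P[v v0 vM] : \det M == 0 by move: nuM; rewrite unitmxE unitfE negbK.
have [i1 vi1] : exists i, v 0 i != 0.
  apply/existsP; apply: contraNT v0 => /existsPn v0; apply/eqP/rowP => i.
  by rewrite mxE; apply/eqP; rewrite -[_ == _]negbK v0.
have [i0 vi0 amax] :=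
  @Order.TotalTheory.arg_maxP _ _ _ i1 (fun i => v 0 i != 0) a vi1.
(* Adding u g to row i0 turns its coefficients of t^(a i0) into those of (v M) / v_i0 = 0. The
   exponents a i0 - a j are nonnegative where v_j != 0, by the choice of i0. *)
pose u : 'rV[L]_d := \row_j (if j == i0 then 0 else
  lterm (v 0 j / v 0 i0) (a i0 - a j)).
have [c pc cE] : exists2 c : GL k d, GLsub (@lpoly k) c &
    val c = 1%:M + delta_mx i0 (0 : 'I_1) *m u.
  apply: transvection_poly => [|j]; rewrite mxE ?eqxx//; case: eqP => // _.
  have [->|vj] := eqVneq (v 0 j) 0; first by rewrite mul0r lterm0.
  by apply: lpoly_lterm; rewrite subr_ge0; exact: amax.
exists c, (fun i => a i - (i == i0)%:Z); split=> //; last first.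
  rewrite sumrB; congr (_ - _); rewrite (bigD1 i0)//= eqxx big1 ?addr0// => i.
  by move=> /negPf->.
have cgE i j : val (c * g)%g i j = val g i j + (i == i0)%:R * (u *m val g) 0 j.
  rewrite [val _]/= cE mulmxDl mul1mx mxE; congr (_ + _).
  by rewrite -mulmxA mxE big_ord1 mxE andbT.
move=> i j; rewrite cgE; have [->|_] := eqVneq i i0; last first.
  by rewrite mul0r addr0 subr0.
rewrite mul1r; apply: dle_pred.
  apply: dleD => //; rewrite mxE; apply: dle_sum => l _; rewrite !mxE.
  case: eqP => _; first by rewrite mul0r.
  by have := dleM (@dle_lterm _ (v 0 l / v 0 i0) (a i0 - a l)) (ga l j); rewrite subrK.
have /rowP/(_ j) := vM; rewrite !mxE (bigD1 i0)//= => /(congr1 ( *%R (v 0 i0)^-1)).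
rewrite mulr0 mulrDr mulKf// => vM0; rewrite -[RHS]vM0.
rewrite [LHS](_ : _ = val g i0 j (a i0) +
  (\sum_l u 0 l * val g l j) (a i0))//.
rewrite [M i0 j]mxE; congr (_ + _); rewrite coef_sum (bigD1 i0)//.
have -> : u 0 i0 = 0 by rewrite mxE eqxx.
rewrite mul0r; apply: (etrans (add0r _)); rewrite mulr_sumr.
apply: eq_bigr => l /negPf li.
by rewrite !mxE li ltermMl opprB addrC subrK mulrA [_^-1 * _]mulrC.
Qed.

(* The degree of the determinant bounds the descent. *)
Lemma row_reduction_from (n : nat) g (a : 'I_d -> int) :
  (forall i j, dle (val g i j) (a i)) ->
  \sum_i a i < ldeg (\det (val g)) + n%:Z ->
  exists c b h, [/\ GLsub (@lpoly k) c, GLsub (@lring k) h &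
    (c * g = tdiag b * h)%g].
Proof.
elim: n g a => [|n IH] g a ga sa.
  (* With no steps left, the row bounds sum to less than the degree of the determinant, against the
     Leibniz bound. *)
  have /(ldeg_le _ (det_GL_neq0 g)) := dle_det ga; lia.
have [uM|nuM] := boolP ((\matrix_(i, j) val g i j (a i)) \in unitmx).
  (* When the matrix of leading coefficients is invertible, t^-a g has entries in k[[t^-1]] and that
     matrix as its reduction, so it lies in GL_d(k[[t^-1]]). *)
  exists 1%g, a, ((tdiag a)^-1 * g)%g; rewrite mul1g mulVKg; split=> //.
    exact: GLsub_poly1.
  have rg i j : lring (val ((tdiag a)^-1 * g)%g i j).
    rewrite -tdiagN tdiagMl; apply/lring_dle.
    by rewrite -(addNr (a i)); apply: dleM => //; exact: dle_lmon.
  split=> //; apply: lring_invmx => //; first exact: valP.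
  rewrite (_ : \matrix_(i, j) _ = \matrix_(i, j) val g i j (a i))//.
  by apply/matrixP => i j; rewrite [LHS]mxE [RHS]mxE -tdiagN tdiagMl lmonMl sub0r opprK.
have [c [b [pc cgb sb]]] := row_reduction_step ga nuM.
have [|c' [b' [h [pc' rh cgE]]]] := IH _ _ cgb.
  rewrite ldeg_detM ldeg_det_poly// sb.
  by rewrite add0r ltrBlDr -addrA; rewrite -(addn1 n) PoszD in sa.
exists (c' * c)%g, b', h; split; rewrite -?mulgA//.
exact: GLsubM (lpoly_subring k) _ _.
Qed.

Lemma row_reduction g : exists c b h,
  [/\ GLsub (@lpoly k) c, GLsub (@lring k) h & (c * g = tdiag b * h)%g].
Proof.
have [N gN] := dle_matrix_bound (val g).
pose e := \sum_(i < d) N%:Z - ldeg (\det (val g)) + 1.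
apply: (@row_reduction_from `|e|%N g (fun=> N%:Z) gN).
have := ler_norm e; rewrite -abszE.
by rewrite /e -ltrBlDl => /(lt_le_trans _); apply; rewrite ltrDl.
Qed.

End ReductionTheory.

(** * Openness of the double cosets *)

Section Openness.
Local Open Scope quotient_scope.
Variables (k : finFieldType) (d : nat).
Local Notation L := (laurent k).
Local Notation G := (PGL k d).
Implicit Types (g h : GL k d) (S : set G).

Lemma agree_above_open (x : L) (N : int) :
  open [set y : L | forall n, N < n -> y n = x n].
Proof. by move=> y yx; exists N => z zy n Nn; rewrite zy// yx. Qed.

(** Here g^-1 h = 1 + g^-1 (h - g). If M bounds the degrees in g^-1, the threshold -M - 1 leaves
    degree at most -1 in the second term, so g^-1 h is integral with reduction 1. *)
Lemma GLsub_ring_near g : exists N : int, forall h,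
  (forall i j n, N < n -> val h i j n = val g i j n) ->
  GLsub (@lring k) (g^-1 * h)%g.
Proof.
have [M gM] := dle_matrix_bound (val g^-1%g); exists (- M%:Z - 1) => h hg.
pose E := val g^-1%g *m (val h - val g).
have ghE : val (g^-1 * h)%g = 1%:M + E.
  by rewrite /E mulmxBr [val g^-1%g]/= mulVmx ?(valP g)// addrC subrK.
have dE i j : dle (E i j) (-1).
  rewrite mxE; apply: dle_sum => l _.
  apply: (@dle_trans _ (M%:Z + (- M%:Z - 1))); last by lia.
  apply: dleM => // n Mn; rewrite !mxE [LHS](_ : _ = val h l j n - val g l j n)//.
  by rewrite hg// subrr.
have rE i j : lring (val (g^-1 * h)%g i j).
  rewrite ghE mxE; apply/lring_dle/dleD; last exact: dle_trans (dE i j) _.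
  by rewrite mxE; case: (i == j); [exact: dle1|exact: dle0].
split=> //; apply: lring_invmx => //; first exact: valP.
rewrite (_ : \matrix_(i, j) _ = 1%:M) ?unitmx1//; apply/matrixP => i j.
rewrite mxE ghE mxE [LHS](_ : _ = (1%:M : 'M[L]_d) i j 0 + E i j 0)// dE// addr0.
by rewrite !mxE; case: (i == j).
Qed.

(** With each x the set contains x K, a neighbourhood of x by [GLsub_ring_near]. The open set of
    matrices required by the initial topology on GL_d is the union of the interiors of the balls
    [W g]. *)
Lemma right_invariant_open S :
  (forall x u, S x -> PGL_int d u -> S (x * u)%g) -> open S.
Proof.
move=> SK; pose U : set (GL k d) := \pi_G @^-1` S.
have /choice[N gN] := GLsub_ring_near.
pose W g : set 'M[L]_d :=
  [set A : 'M[L]_d | forall i j n, N g < n -> A i j n = val g i j n].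
exists (\bigcup_(g in U) (W g)°).
  by apply: bigcup_open => g _; exact: open_interior.
apply/seteqP; split=> [h [g Ug /interior_subset hg]|g Ug]; last first.
  exists g => //.
  exists (fun i j => [set y : L | forall n, N g < n -> y n = val g i j n]).
    by move=> i j; apply: open_nbhs_nbhs; split => //; exact: agree_above_open.
  by move=> A gA i j n; exact: gA.
have /(_ hg) ghK := gN g h.
rewrite /U/= -(mulVKg g h) [X in S X](_ : _ = (\pi_G g * \pi_G (g^-1 * h))%g).
  by apply: SK => //; exists (g^-1 * h)%g.
by rewrite -PGLmulE.
Qed.

Lemma right_invariant_measurable S :
  (forall x u, S x -> PGL_int d u -> S (x * u)%g) -> measurable S.
Proof. by move=> /right_invariant_open; exact: sub_sigma_algebra. Qed.

Lemma Ydc_all_measurable (A : set (Ydc k d)) : measurable A.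
Proof.
apply: right_invariant_measurable => x h /= Ax hK.
rewrite (_ : \pi_(Ydc k d) (x * h)%g = \pi_(Ydc k d) x)//.
apply/esym/(@eqmodP _ (@dcoset_equiv k d))/asboolP; exists 1%g, h.
by rewrite mul1g; split=> //; exact: PGLsub1 (lpoly_subring k).
Qed.

Lemma Ydc_all_measurable_fun (d' : measure_display) (T : measurableType d')
  (f : Ydc k d -> T) : measurable_fun setT f.
Proof. by move=> _ A _; exact: Ydc_all_measurable. Qed.

End Openness.

(** * Masses of the points of Y *)

Section PointMasses.
Local Open Scope quotient_scope.
Local Open Scope ereal_scope.
Variables (R : realType) (k : finFieldType) (d : nat).
Local Notation G := (PGL k d).
Implicit Types (x y z : G).

Definition coset_PGL_int x : set G := [set (x * u)%g | u in PGL_int d].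

(* the order of Gamma :&: x K x^-1 *)
Definition stab_card x : \bar R :=
  \esum_(c in PGL_poly d) (\1_(coset_PGL_int x) (c * x)%g)%:E.

Lemma coset_PGL_intMr x y u :
  PGL_int d u -> coset_PGL_int x (y * u)%g <-> coset_PGL_int x y.
Proof.
move=> uK; split=> [[v vK xv]|[v vK <-]].
- exists (v * u^-1)%g; last by rewrite mulgA xv mulgK.
  by apply: PGLsubM (lring_subring k) _ _ => //; exact: PGLsubV.
- exists (v * u)%g; last by rewrite mulgA.
  exact: PGLsubM (lring_subring k) _ _.
Qed.

Lemma coset_PGL_int_measurable x : measurable (coset_PGL_int x).
Proof.
by apply: right_invariant_measurable => y u xy uK; apply/coset_PGL_intMr.
Qed.

Lemma pi_YdcP x y : \pi_(Ydc k d) x = \pi_(Ydc k d) y <->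
  exists c u, [/\ PGL_poly d c, PGL_int d u & y = (c * x * u)%g].
Proof.
have E := @eqmodP _ (@dcoset_equiv k d) x y.
by split=> [/E/asboolP//|xy]; apply/E/asboolP.
Qed.

(** Right translation by c permutes Gamma and u is absorbed by x K, so the sum over Gamma in the
    quotient formula is the same at every representative of the double coset. *)
Lemma stab_card_translate x c u : PGL_poly d c -> PGL_int d u ->
  \esum_(b in PGL_poly d) (\1_(coset_PGL_int x) (b * (c * x * u))%g)%:E =
  stab_card x.
Proof.
move=> cG uK; rewrite /stab_card.
rewrite [RHS](@reindex_esum _ _ _ (PGL_poly d) _ (fun b => b * c)%g).
  apply: eq_esum => b _; congr _%:E; rewrite !indicE !mulgA; congr ((nat_of_bool _)%:R).
  have E := @coset_PGL_intMr x (b * c * x)%g _ uK.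
  by apply/idP/idP => /set_mem h; apply/mem_set/E.
split=> [b bG|b b' _ _ /mulIg//|b bG]; first exact: PGLsubM (lpoly_subring k) _ _.
exists (b * c^-1)%g; last by rewrite mulgVK.
by apply: PGLsubM (lpoly_subring k) _ _ => //; exact: PGLsubV.
Qed.

Variables (vol : {measure set G -> \bar R}) (vol_haar : is_haar vol).
Variables (vol_K : vol (PGL_int d) = 1).
Variables (m : {measure set (GammaG k d) -> \bar R}).
Variable (m_quot : is_quotient_measure vol m).

Lemma PGL_int_measurable : measurable (@PGL_int k d).
Proof.
apply: right_invariant_measurable => x u xK uK.
exact: PGLsubM (lring_subring k) _ _.
Qed.

(* The defining identity of the quotient measure at the indicator of x K. *)
Lemma stab_card_nuY x : stab_card x * nuY m [set \pi_(Ydc k d) x] = 1.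
Proof.
have mxK := coset_PGL_int_measurable x.
have [_ _ vol_inv] := vol_haar.
have := m_quot (f := fun y => (\1_(coset_PGL_int x) y)%:E).
rewrite integral_indic// setIT vol_inv ?vol_K; last exact: PGL_int_measurable.
move=> ->; last 2 first.
- by apply/measurable_EFinP; exact: measurable_indic.
- by move=> y; rewrite lee_fin indicE.
pose D := @projY k d @^-1` [set \pi_(Ydc k d) x].
have mD : measurable D.
  by rewrite -[D]setTI; apply: measurable_projY => //; exact: Ydc_all_measurable.
rewrite /nuY /pushforward -(integral_cst m mD) integral_mkcond.
(* The sum over Gamma is [stab_card] over the given point of Y and 0 elsewhere, since c z in x K
   puts z in Gamma x K. *)
apply: eq_integral => z _; rewrite patchE; case: ifPn => [/set_mem|/negP zD].
  rewrite /D/= /projY => /esym/pi_YdcP[c [u [cG uK ->]]].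
  by rewrite stab_card_translate.
rewrite esum1// => c cG; rewrite indicE memNset// => -[u uK cz].
apply/zD/mem_set => /=; apply/esym/pi_YdcP; exists c^-1%g, u.
by split=> //; [exact: PGLsubV|rewrite -mulgA cz mulKg].
Qed.

End PointMasses.

(** * Orders of the stabilizers *)

Section EsumCard.
Local Open Scope ereal_scope.
Variables (R : realType) (T : choiceType) (I : finType) (P : pred I).
Implicit Types (A : set T) (a : T -> \bar R).

Lemma fsum1_card : \sum_(i \in [set` P]) (1 : \bar R) = #|P|%:R%:E.
Proof.
rewrite -(bigfs _ (index_enum_uniq I))/=; last by move=> i _; rewrite mem_index_enum.
by rewrite sumEFin sumr_const.
Qed.

Lemma esum_ge_card A a (F : I -> T) : set_inj [set` P] F ->
  (forall i, P i -> A (F i)) -> (forall i, P i -> 1 <= a (F i)) ->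
  #|P|%:R%:E <= \esum_(x in A) a x.
Proof.
move=> Finj FA Fa; apply: esum_ge; exists (F @` [set` P]).
  by split; [exact/finite_image/finite_finset|move=> _ [i Pi <-]; exact: FA].
rewrite fsbig_image// -fsum1_card; by apply: lee_fsum => // i Pi; exact: Fa.
Qed.

Lemma esum_le_card A a (F : T -> I) : set_inj [set x | A x /\ a x != 0] F ->
  (forall x, A x -> a x != 0 -> P (F x)) -> (forall x, A x -> a x <= 1) ->
  \esum_(x in A) a x <= #|P|%:R%:E.
Proof.
move=> Finj FP Fa; pose B := [set x | a x != 0].
apply: (@le_trans _ _ (\esum_(x in A `&` B) 1)).
  rewrite esum_mkcondr; apply: le_esum => x Ax.
  by case: ifPn => [_|/negP xB]; [exact: Fa|rewrite leNgt lt_neqAle;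
    apply/negP => /andP[ax _]; apply/xB/mem_set; rewrite /B/= eq_sym].
rewrite -(@esum_image _ _ _ (A `&` B) F (fun=> 1))// -fsum1_card.
rewrite -esum_fset//.
apply: le_ereal_sup; apply: image_subset => X [finX XF]; split=> //.
by move=> i /XF[x [Ax Bx] <-]; exact: FP.
Qed.

End EsumCard.

(** Up to reordering by a the matrix is triangular. If the product for s is nonzero, then a (s i) <=
    a i, strictly when s i != i; both sides have the same sum over i, so s = 1. *)
Lemma det_unipotent (R : comNzRingType) n (A : 'M[R]_n) (a : 'I_n -> nat) :
  (forall i, A i i = 1) -> (forall i j, i != j -> A i j != 0 -> (a j < a i)%N) ->
  \det A = 1.
Proof.
move=> A1 Aa; rewrite /determinant (bigD1 (1%g : {perm 'I_n}))//= odd_perm1.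
rewrite expr0 mul1r [X in X + _]big1 => [|i _]; last by rewrite perm1 A1.
rewrite big1 ?addr0// => s s1.
have [/forallP As|] := boolP [forall i, A i (s i) != 0]; last first.
  by move=> /forallPn[i]; rewrite negbK => /eqP Ai; rewrite (bigD1 i)//= Ai mul0r mulr0.
have le_as i : true -> (a (s i) <= a i ?= iff (a (s i) == a i))%N.
  move=> _; split=> //; have [->//|si] := eqVneq (s i) i; apply/ltnW/Aa => //.
  by rewrite eq_sym.
have [_] := leqif_sum le_as.
rewrite [X in _ == X](reindex_inj (@perm_inj _ s)) eqxx => /esym/forallP asE.
case/negP: s1; apply/eqP/permP => i; rewrite perm1; apply/eqP.
apply: contraTT (asE i) => si; rewrite /= neq_ltn Aa// eq_sym//.
Qed.

Lemma sum_nat_ltn M c : (c <= M)%N -> (\sum_(m < M) (m < c)%N = c)%N.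
Proof.
move=> cM; have := @big_ord_widen _ 0%N addn _ M (fun=> 1%N) cM.
rewrite sum_nat_const card_ord muln1 => cE; rewrite [RHS]cE [RHS]big_mkcond /=.
by apply: eq_bigr => i _; case: ltnP.
Qed.

(** * Two-sided bounds for the stabilizer of the point of t^a *)

Section StabilizerBounds.
Local Open Scope quotient_scope.
Variables (R : realType) (k : finFieldType) (d : nat).
Local Notation L := (laurent k).
Local Notation G := (PGL k d).
Implicit Types (a : 'I_d -> nat) (g h : GL k d).

(* t^a *)
Definition tmat a : GL k d := tdiag k (fun i => (a i)%:Z).

(* h(a); the subtraction is truncated at 0 *)
Definition spread a : nat := (\sum_i \sum_j (a i - a j))%N.

(** Polynomial matrices of degree below M, encoded by their coefficients in a finite type so that
    they can be counted. *)
Definition poly_mx M (f : {ffun 'I_d * 'I_d * 'I_M -> k}) : 'M[L]_d :=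
  \matrix_(i, j) \sum_(m < M) lterm (f (i, j, m)) m%:Z.

Lemma poly_mx_coef M (f : {ffun 'I_d * 'I_d * 'I_M -> k}) i j (m : 'I_M) :
  poly_mx f i j m%:Z = f (i, j, m).
Proof.
rewrite mxE coef_sum (bigD1 m)//= eqxx big1 ?addr0// => l lm.
by rewrite ifF//; apply/negP => /eqP[] /val_inj ml; rewrite ml eqxx in lm.
Qed.

Lemma poly_mx_lpoly M f i j : lpoly (poly_mx (M := M) f i j).
Proof.
move=> n n0; rewrite mxE coef_sum big1// => m _ /=.
by case: eqP => // nm; move: n0; rewrite nm.
Qed.

Lemma poly_mx_dle M (f : {ffun 'I_d * 'I_d * 'I_M -> k}) i j N :
  (forall m, f (i, j, m) != 0 -> m%:Z <= N) -> dle (poly_mx (M := M) f i j) N.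
Proof.
move=> fN; rewrite mxE; apply: dle_sum => m _.
have [->|/fN] := eqVneq (f (i, j, m)) 0; first by rewrite lterm0.
by apply: dle_trans; exact: dle_lterm.
Qed.

Lemma unipotent_GLsub (S : set L) (A : 'M[L]_d) a :
  subring_set S -> (forall x, S x -> S (- x)) -> (forall i j, S (A i j)) ->
  (forall i, A i i = 1) -> (forall i j, i != j -> A i j != 0 -> (a j < a i)%N) ->
  exists2 g : GL k d, GLsub S g & val g = A.
Proof.
move=> hS hN SA A1 Aa; have dA := det_unipotent A1 Aa.
have uA : A \in unitmx by rewrite unitmxE dA unitr1.
exists (exist (fun g : 'M[L]_d => g \in unitmx) _ uA) => //; split=> // i j.
by apply: (subring_invmx hS hN) => //; rewrite dA invr1; have [] := hS.
Qed.

Lemma coset_PGL_intP g h : coset_PGL_int (\pi_G g) (\pi_G h) <->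
  exists2 u : GL k d, GLsub (@lring k) u & \pi_G h = \pi_G (g * u)%g.
Proof.
split=> [[_ [u uK <-] <-]|[u uK ->]]; first by exists u => //; rewrite -PGLmulE.
by exists (\pi_G u); [exists u|rewrite -PGLmulE].
Qed.

(** The matrices g = 1 + N with deg N_ij < a_i - a_j are unipotent over k[t], and t^-a g t^a is
    integral. The entry (i, j) has max(a_i - a_j, 0) free coefficients, which gives q^h(a)
    matrices. *)
Lemma stab_card_ge a :
  ((#|k| ^ spread a)%:R%:E <= stab_card R (\pi_G (tmat a)))%E.
Proof.
pose M := (\sum_i a i)%N.
have aM i : (a i <= M)%N by rewrite /M (bigD1 i)//= leq_addr.
pose D := [pred x : 'I_d * 'I_d * 'I_M | x.2 + a x.1.2 < a x.1.1]%N.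
have Dcard : #|D| = spread a.
  rewrite -sum1_card big_mkcond /= /spread pair_bigA /=.
  rewrite -(pair_big_dep xpredT (fun _ _ => true)
    (fun ij m => if (ij, m) \in D then 1%N else 0%N))/=.
  apply: eq_bigr => -[i j] _ /=.
  rewrite -(@sum_nat_ltn M (a i - a j)) ?(leq_trans (leq_subr _ _))//.
  by apply: eq_bigr => m _; rewrite inE /= ltn_subRL addnC; case: ltnP.
pose P := pffun_on (0 : k) D predT.
have PD f : f \in P -> forall i j m, f (i, j, m) != 0 -> (m + a j < a i)%N.
  move=> /pffun_onP[/fintype.subsetP fD _] i j m fijm.
  by have := fD (i, j, m); rewrite !inE; apply.
have A1 f : f \in P -> forall i, (1%:M + poly_mx f) i i = 1.
  move=> fP i; rewrite mxE mxE eqxx mxE big1 ?addr0// => m _.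
  have [->|/(PD f fP)] := eqVneq (f (i, i, m)) 0; first by rewrite lterm0.
  by rewrite ltnNge leq_addl.
have Aa f : f \in P ->
    forall i j, i != j -> (1%:M + poly_mx f) i j != 0 -> (a j < a i)%N.
  move=> fP i j /negPf ij; apply: contraNT; rewrite -leqNgt => aij.
  rewrite mxE mxE ij add0r mxE big1// => m _.
  have [->|/(PD f fP)] := eqVneq (f (i, j, m)) 0; first by rewrite lterm0.
  by rewrite ltnNge (leq_trans aij) ?leq_addl.
have GA f : f \in P ->
    exists2 g : GL k d, GLsub (@lpoly k) g & val g = 1%:M + poly_mx f.
  move=> fP; apply: (@unipotent_GLsub _ _ a (lpoly_subring k)).
  - exact: lpolyN.
  - have [S0 S1 SD _] := lpoly_subring k; move=> i j; rewrite mxE; apply: SD.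
      by rewrite mxE; case: (i == j).
    exact: poly_mx_lpoly.
  - exact: A1.
  - exact: Aa.
have conj f g : f \in P -> val g = 1%:M + poly_mx f ->
    coset_PGL_int (\pi_G (tmat a)) (\pi_G (g * tmat a)%g).
  move=> fP gE; apply/coset_PGL_intP.
  (* The matrix t^-a g t^a, which witnesses that g t^a lies in t^a K. *)
  pose B : 'M[L]_d := \matrix_(i, j) (lmon k (- (a i)%:Z + (a j)%:Z) * val g i j).
  have [] := @unipotent_GLsub _ B a (lring_subring k) (@lringN k).
  - move=> i j; rewrite mxE gE; apply/lring_dle; have [->|ij] := eqVneq i j.
      rewrite A1// mulr1 addNr; exact: dle_lmon.
    apply: (@dle_trans _ ((- (a i)%:Z + (a j)%:Z) + ((a i)%:Z - (a j)%:Z))).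
      apply: dleM; first exact: dle_lmon.
      rewrite mxE mxE (negPf ij) add0r; apply: poly_mx_dle => m /(PD f fP) /ltnW.
      by lia.
    by lia.
  - by move=> i; rewrite mxE gE A1// mulr1 addNr lmon0.
  - move=> i j ij; rewrite mxE gE; apply: contraNT => aij.
    rewrite (_ : (1%:M + _) i j = 0) ?mulr0//; apply/eqP.
    by apply: contraNT aij; exact: Aa.
  move=> u uS uE; exists u => //; congr (\pi_G _); apply: val_inj.
  apply/matrixP => i j; rewrite [LHS]tdiagMr [RHS]tdiagMl uE mxE lmonD mulrA.
  by rewrite mulrA -lmonD addrN lmon0 mul1r mulrC.
have /choice[F FP] : forall f, exists c : G, f \in P ->
    [/\ PGL_poly d c, coset_PGL_int (\pi_G (tmat a)) (c * \pi_G (tmat a))%g &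
      exists2 g, c = \pi_G g & val g = 1%:M + poly_mx f].
  move=> f; case/boolP: (f \in P) => [fP|_]; last by exists 1%g.
  have [g gS gE] := GA f fP; exists (\pi_G g) => _; split.
  - by exists g.
  - by rewrite -[(_ * _)%g]/(PGLmul _ _) PGLmulE; exact: (conj f).
  - by exists g.
rewrite (_ : (#|k| ^ spread a)%N = #|P|); last by rewrite card_pffun_on Dcard.
apply: (@esum_ge_card _ _ _ _ _ _ F) => [f f'|f /FP[]//|f /FP[_ fS _]].
  move=> /set_mem/= fP /set_mem/= f'P FE.
  have [_ _ [g gE gf]] := FP f fP; have [_ _ [g' g'E g'f']] := FP f' f'P.
  move: FE; rewrite gE g'E => /PGL_eqP[c c0]; rewrite gf g'f' => E.
  apply/ffunP => -[[i j] m].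
  (* Equality in PGL_d leaves a scalar c, which the diagonal entries, all 1, determine. *)
  have c1 : c = 1.
    by move/matrixP : (E) => /(_ i i); rewrite [X in _ = X]mxE !A1// mulr1 => ->.
  by move: E; rewrite c1 scale1r => /addrI E; rewrite -!poly_mx_coef E.
by rewrite indicE mem_set.
Qed.

(** Lifted to GL_d the hypothesis reads t^a u = c g t^a. Comparing degrees of determinants gives d
    deg c = 0, and then g = c^-1 t^a u t^-a is bounded entry by entry. *)
Lemma stabilizer_dle a g : GLsub (@lpoly k) g ->
  coset_PGL_int (\pi_G (tmat a)) (\pi_G (g * tmat a)%g) ->
  forall i j, dle (val g i j) ((a i)%:Z - (a j)%:Z).
Proof.
move=> gS /coset_PGL_intP[u uS /PGL_eqP[c c0 E]] i j.
have dc : ldeg c = 0.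
  have X n : ldeg (c ^+ n) = ldeg c *+ n.
    by elim: n => [|n IH]; rewrite ?expr0 ?ldeg1// exprS ldegM ?expf_neq0// IH mulrS.
  have : ldeg (\det (val (tmat a * u)%g)) =
      ldeg c *+ d + ldeg (\det (val (g * tmat a)%g)).
    rewrite [X in \det X]E (detZ c (val (g * tmat a)%g)) -X; apply: ldegM.
      by rewrite expf_neq0.
    exact: det_GL_neq0.
  rewrite (ldeg_detM (tmat a) u) (ldeg_detM g (tmat a)) (ldeg_det_poly gS).
  rewrite (ldeg_det_ring uS) addr0 add0r -[LHS]add0r => /addIr/esym/eqP.
  rewrite mulrn_eq0 => /orP[|/eqP//].
  by move/eqP => d0; move: i; rewrite d0 => -[].
have /matrixP/(_ i j) := E; rewrite [RHS]mxE [LHS]tdiagMl [in RHS]tdiagMr.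
move=> ch; have -> : val g i j =
    c^-1 * (lmon k (a i)%:Z * val u i j) * lmon k (- (a j)%:Z).
  by rewrite ch mulKf// -mulrA -lmonD addrN lmon0 mulr1.
apply: dleM; last exact: dle_lmon.
have cV : dle c^-1 0.
  apply/ldeg_le; first by rewrite invr_eq0.
  by have := ldegM c0 (invr_neq0 c0); rewrite divff// ldeg1 dc add0r => <-.
have /lring_dle ru := uS.1 i j.
by have := dleM cV (dleM (@dle_lmon _ (a i)%:Z) ru); rewrite addr0 add0r.
Qed.

(** An element of the stabilizer is determined by the coefficients of a polynomial representative.
    Its entry (i, j) has at most max(a_i - a_j, 0) + 1 of them, hence the additional d^2 in the
    exponent. *)
Lemma stab_card_le a :
  (stab_card R (\pi_G (tmat a)) <= (#|k| ^ (spread a + d * d))%:R%:E)%E.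
Proof.
(* The degree a i - a j itself may occur, so the coefficients are indexed below a successor. *)
pose M := (\sum_i a i).+1.
have aM i : (a i < M)%N by rewrite /M ltnS (bigD1 i)//= leq_addr.
pose D := [pred x : 'I_d * 'I_d * 'I_M | x.2 + a x.1.2 <= a x.1.1]%N.
have Dcard : (#|D| <= spread a + d * d)%N.
  rewrite -sum1_card big_mkcond /= /spread pair_bigA /=.
  rewrite -(pair_big_dep xpredT (fun _ _ => true)
    (fun ij m => if (ij, m) \in D then 1%N else 0%N))/=.
  have -> : (d * d = \sum_(p : 'I_d * 'I_d) 1)%N.
    by rewrite sum_nat_const card_prod card_ord muln1.
  rewrite -big_split /=; apply: leq_sum => -[i j] _ /=.
  have ijM : (a i - a j < M)%N by rewrite (leq_ltn_trans (leq_subr _ _)).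
  rewrite addn1 -(sum_nat_ltn ijM); apply: leq_sum => m _; rewrite inE /=.
  case: (leqP (m + a j) (a i)) => // mij.
  by rewrite lt0b ?ltnS leq_subRL ?(leq_trans (leq_addl _ _) mij)// addnC mij.
pose P := pffun_on (0 : k) D predT.
have /choice[F FP] : forall c : G, exists g : GL k d,
    PGL_poly d c -> GLsub (@lpoly k) g /\ \pi_G g = c.
  move=> c; have [[g gS gc]|cP] := pselect (PGL_poly d c); first by exists g.
  by exists 1%g.
pose phi (c : G) : {ffun 'I_d * 'I_d * 'I_M -> k} :=
  [ffun x : 'I_d * 'I_d * 'I_M => val (F c) x.1.1 x.1.2 (x.2 : nat)%:Z].
have cS c : PGL_poly d c -> (\1_(coset_PGL_int (\pi_G (tmat a)))
    (c * \pi_G (tmat a))%g)%:E != 0 :> \bar R ->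
    GLsub (@lpoly k) (F c) /\ forall i j, dle (val (F c) i j) ((a i)%:Z - (a j)%:Z).
  move=> cG; have [gS gc] := FP c cG; rewrite -[in X in X -> _]gc eqe indicE.
  rewrite -[(_ * _)%g]/(PGLmul _ _) PGLmulE => h; split=> //.
  apply: stabilizer_dle => //; apply: contrapT => h'.
  by move: h; rewrite memNset// eqxx.
apply: (@le_trans _ _ #|P|%:R%:E); last first.
  rewrite lee_fin ler_nat card_pffun_on leq_exp2l//.
  by rewrite -(ltr_nat R) (q_gt1 k R).
apply: (@esum_le_card _ _ _ _ _ _ phi) => [c c'|c cG cK|c cG].
- move=> /set_mem[cG cK] /set_mem[c'G c'K] E.
  have [[gS _] gd] := cS c cG cK; have [[g'S _] g'd] := cS c' c'G c'K.
  rewrite -(FP c cG).2 -(FP c' c'G).2; congr (\pi_G _); apply: val_inj.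
  apply/matrixP => i j; apply: laurentP => n.
  have [n0|n0] := ltP n 0; first by rewrite gS// g'S.
  have [nM|Mn] := ltP n M%:Z; last first.
    by rewrite gd ?g'd//; move: Mn (aM i); lia.
  have nM' : (`|n| < M)%N by lia.
  move/ffunP : E => /(_ (i, j, Ordinal nM')); rewrite !ffunE /=.
  by rewrite gez0_abs.
- apply/pffun_onP; split=> //; apply/fintype.subsetP => -[[i j] m].
  rewrite inE /= ffunE /=; have [_ gd] := cS c cG cK => gm.
  rewrite inE /= leqNgt; apply: contra_neqN gm => am.
  by rewrite (gd i j)//; lia.
- by rewrite lee_fin indicE lern1 leq_b1.
Qed.

End StabilizerBounds.

(** * Norms of exterior products *)

Section WedgeNorm.
Variables (R : realType) (k : finFieldType) (d : nat).
Local Notation L := (laurent k).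
Local Notation abs := (@labs R k).
Local Notation q := (#|k|%:R : R).

(** The Cauchy-Binet formula before grouping: the sum runs over all maps f rather than increasing
    ones. *)
Lemma det_mulmx_rect (K : comNzRingType) m n (A : 'M[K]_(m, n)) (B : 'M[K]_(n, m)) :
  \det (A *m B) =
  \sum_(f : {ffun 'I_m -> 'I_n}) (\prod_i A i (f i)) * \det (rowsub f B).
Proof.
under [RHS]eq_bigr do rewrite mulr_sumr.
rewrite exchange_big; apply: eq_bigr => s _ /=.
rewrite (eq_bigr (fun i => \sum_l A i l * B l (s i))) => [|i _]; last by rewrite mxE.
rewrite bigA_distr_bigA mulr_sumr; apply: eq_bigr => f _ /=.
rewrite mulrCA -big_split; congr (_ * _).
by apply: eq_bigr => i _; rewrite mxE.
Qed.

(** The permutation sorts the values of f. It gives access to [wedge_norm], which ranges over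
    increasing maps. *)
Lemma sort_injection j (f : 'I_j -> 'I_d) : injective f -> exists s : {perm 'I_j},
  forall a b : 'I_j, (a < b)%N -> (f (s a) < f (s b))%N.
Proof.
move=> finj; pose le (x y : 'I_d) := (x <= y)%N.
have le_tr : transitive le by move=> x y z; exact: leq_trans.
pose t := [tuple f i | i < j].
have /tuple_permP[s sE] : perm_eq (sort_tuple le t) t by rewrite /= perm_sort.
exists s => a b ab.
have nthE (c : 'I_j) : nth (f a) (sort le t) c = f (s c).
  by rewrite [sort _ _]sE nth_mktuple tnth_mktuple.
have st : sorted le (sort le t) by apply: sort_sorted => x y; exact: leq_total.
have := sorted_leq_nth le_tr (fun x => leqnn x) (f a) st.
have sz (c : 'I_j) : (c : nat) \in [pred n | (n < size (sort le t))%N].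
  by rewrite inE size_sort size_tuple.
move=> /(_ _ _ (sz a) (sz b) (ltnW ab)); rewrite !nthE /le leq_eqVlt.
by move=> /orP[/eqP/val_inj/finj/perm_inj abE|//]; rewrite abE ltnn in ab.
Qed.

Lemma abs_sign (b : bool) (x : L) : abs ((-1) ^+ b * x) = abs x.
Proof.
rewrite absM absX; suff -> : abs (-1) = 1 by rewrite expr1n mul1r.
apply/eqP; rewrite -(@pexpr_eq1 _ _ 2)// ?abs_ge0//.
by rewrite -absX sqrrN expr1n abs1.
Qed.

Lemma wedge_norm_ge0 j (v : j.-tuple 'cV[L]_d) : 0 <= wedge_norm R v.
Proof. by apply: (big_ind (fun x => 0 <= x)) => // [x y x0|I _];
  [rewrite le_max x0|exact: abs_ge0]. Qed.

(** A repeated row makes the minor vanish, and sorting distinct rows changes at most its sign. *)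
Lemma abs_minor_le j (v : j.-tuple 'cV[L]_d) (f : 'I_j -> 'I_d) :
  abs (\det (\matrix_(a, b) tnth v b (f a) 0)) <= wedge_norm R v.
Proof.
have [/injectiveP finj|/injectivePn[a [b ab fab]]] := boolP (injectiveb f); last first.
  rewrite (determinant_alternate ab) ?abs0 ?wedge_norm_ge0// => c.
  by rewrite !mxE fab.
have [s sf] := sort_injection finj.
pose I : {ffun 'I_j -> 'I_d} := [ffun a => f (s a)].
have -> : abs (\det (\matrix_(a, b) tnth v b (f a) 0)) = abs (wedge_coord v I).
  rewrite /wedge_coord -[LHS](abs_sign s) -det_perm -det_mulmx.
  rewrite -row_permE; congr (abs (\det _)); apply/matrixP => a b.
  by rewrite !mxE ffunE.
apply: (@le_bigmax_cond _ _ _ 0 I _ (fun I => abs (wedge_coord v I))).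
by apply/forallP => a; apply/forallP => b; apply/implyP => ab; rewrite !ffunE sf.
Qed.

(** Integral matrices do not increase the norm: by Cauchy-Binet the determinant is an integral
    combination of minors of v, and the absolute value is ultrametric. *)
Lemma abs_minor_int_le j (v : j.-tuple 'cV[L]_d) (A : 'M[L]_(j, d)) :
  (forall i l, lring (A i l)) ->
  abs (\det (A *m \matrix_(a, b) tnth v b a 0)) <= wedge_norm R v.
Proof.
move=> rA; rewrite det_mulmx_rect; apply: abs_sum_le => [|f _].
  exact: wedge_norm_ge0.
have dA : dle (\prod_i A i (f i)) 0.
  have := @dle_prod _ _ (index_enum 'I_j) xpredT (fun i => A i (f i)) (fun=> 0)
    (fun i _ => rA i _).
  by rewrite sumr_const mul0rn.
apply: le_trans (abs_le_ring R _ dA) _; rewrite expr0z mul1r.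
rewrite (_ : rowsub f _ = \matrix_(a, b) tnth v b (f a) 0) ?abs_minor_le//.
by apply/matrixP => a b; rewrite !mxE.
Qed.

(** Independence of the columns of A P forces P to have rank j, so P has j independent rows. *)
Lemma free_minor j (v : j.-tuple 'cV[L]_d) (A : 'M[L]_d) (P : 'M[L]_(d, j)) :
  free v -> \matrix_(a, b) tnth v b a 0 = A *m P ->
  exists2 f : 'I_j -> 'I_d, injective f & \det (rowsub f P) != 0.
Proof.
move=> /freeP vfree vE.
have fullP : row_full P.
  suff : row_free P^T by rewrite /row_free mxrank_tr.
  apply: inj_row_free => u uP.
  have Pu : P *m u^T = 0 by rewrite -[P]trmxK -trmx_mul uP trmx0.
  have : \sum_(i < j) u 0 i *: v`_i = 0.
    have : (\matrix_(a, b) tnth v b a 0) *m u^T = 0 by rewrite vE -mulmxA Pu mulmx0.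
    move=> /matrixP vu; apply/colP => a; have := vu a 0; rewrite !mxE => vu0.
    rewrite -[RHS]vu0 summxE; apply: eq_bigr => b _.
    by rewrite !mxE mulrC -tnth_nth.
  by move=> /vfree u0; apply/rowP => i; rewrite u0 mxE.
exists (fullrankfun fullP); first exact: fullrankfun_inj.
by have := fullrowsub_unit fullP; rewrite unitmxE unitfE.
Qed.

End WedgeNorm.

(** * Heights of diagonal lattices *)

Section HeightBounds.
Local Open Scope quotient_scope.
Variables (R : realType) (k : finFieldType) (d : nat).
Local Notation L := (laurent k).
Local Notation abs := (@labs R k).
Local Notation q := (#|k|%:R : R).
Implicit Types (a : 'I_d -> nat) (g h c : GL k d).

Definition ytmat a : Ydc k d := \pi_(Ydc k d) (\pi_(PGL k d) (tmat k a)).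

(** Access to [alpha], which is defined through chosen representatives: inversion turns Gamma t^a K
    into K t^-a Gamma, up to a scalar b. *)
Lemma repr_ytmat a : exists (b : L) h c,
  [/\ b != 0, GLsub (@lring k) h, GLsub (@lpoly k) c &
    val (repr (repr (ytmat a)))^-1%g = b *: val (h * (tmat k a)^-1 * c)%g].
Proof.
have /pi_YdcP[_ [_ [[c cS <-] [h hS <-] E]]] :
  ytmat a = \pi_(Ydc k d) (repr (ytmat a)) by rewrite reprK.
have /PGL_eqP[b b0 gE] : \pi_(PGL k d) (c * tmat k a * h)%g =
    \pi_(PGL k d) (repr (repr (ytmat a))).
  by rewrite reprK E -!PGLmulE.
exists b^-1, h^-1%g, c^-1%g; rewrite invr_eq0; split=> //; try exact: GLsubV.
rewrite -mulgA -invgM -[(_^-1 * _)%g]invgM [LHS]/= gE invmxZ//.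
by rewrite unitmxZ ?unitfE// (valP (c * tmat k a * h)%g).
Qed.

Lemma abs_det_poly c : GLsub (@lpoly k) c -> abs (\det (val c)) = 1.
Proof. by move=> cS; rewrite absE ?det_GL_neq0// ldeg_det_poly. Qed.

Lemma abs_det_ring h : GLsub (@lring k) h -> abs (\det (val h)) = 1.
Proof. by move=> hS; rewrite absE ?det_GL_neq0// ldeg_det_ring. Qed.

Lemma q_exp_sum (I : finType) (a : I -> nat) :
  q ^ (- \sum_i (a i)%:Z) = q `^ (- (\sum_i a i)%N%:R).
Proof.
rewrite -powR_intmul ?ler0n//; congr (_ `^ _).
by rewrite rmorphN rmorph_sum natr_sum.
Qed.

Lemma covol_scale (b : L) h c a g : GLsub (@lring k) h -> GLsub (@lpoly k) c ->
  val g = b *: val (h * (tmat k a)^-1 * c)%g ->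
  covol R g = abs b ^+ d * q `^ (- (\sum_i a i)%:R).
Proof.
move=> hS cS gE; rewrite /covol gE (detZ b (val (h * (tmat k a)^-1 * c)%g)).
rewrite absM absX; congr (_ * _).
rewrite (det_GLM (h * (tmat k a)^-1)%g c) (det_GLM h (tmat k a)^-1%g) !absM.
rewrite (abs_det_ring hS) (abs_det_poly cS) mul1r mulr1.
rewrite /tmat -tdiagN det_tdiag abs_lmon.
by rewrite sumrN q_exp_sum.
Qed.

Lemma covol_powR (B : R) (s j : nat) : (0 < d)%N -> 0 <= B ->
  (B ^+ d * q `^ (- s%:R)) `^ (j%:R / d%:R) =
  B ^+ j * q `^ (- (s%:R * j%:R / d%:R)).
Proof.
move=> d0 B0; rewrite powRM ?exprn_ge0 ?powR_ge0//; congr (_ * _).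
  rewrite -(powR_mulrn d B0) -powRrM mulrCA divff ?mulr1 ?powR_mulrn//.
  by rewrite pnatr_eq0 -lt0n.
by rewrite -powRrM mulNr mulrA.
Qed.

(** Sum a_f(i) <= max(a_f(i) - a_l, 0) + a_l over all i and l; as f is injective, the truncated
    differences form part of h(a). *)
Lemma spread_ge a j (f : 'I_j -> 'I_d) : injective f ->
  (d * \sum_i a (f i) <= spread a + j * \sum_l a l)%N.
Proof.
move=> finj.
have -> : (d * \sum_i a (f i) = \sum_(i < j) \sum_(l < d) a (f i))%N.
  rewrite big_distrr /=; apply: eq_bigr => i _.
  by rewrite sum_nat_const card_ord.
apply: (@leq_trans (\sum_(i < j) \sum_(l < d) ((a (f i) - a l) + a l))%N).
  apply: leq_sum => i _; apply: leq_sum => l _.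
  by rewrite addnC -leq_subLR.
rewrite (eq_bigr _ (fun i _ => big_split _ _ _ _ _)) big_split /=.
rewrite sum_nat_const card_ord leq_add2r.
have -> : (\sum_(i < j) \sum_(l < d) (a (f i) - a l) =
    \sum_(m in [set f i | i : 'I_j]%SET) \sum_(l < d) (a m - a l))%N.
  by rewrite big_imset//= => ? ? _ _; exact: finj.
rewrite /spread [X in (_ <= X)%N](bigID (mem [set f i | i : 'I_j]%SET)) /=.
exact: leq_addr.
Qed.

(** Undoing b and h leaves t^-a times a polynomial matrix. A nonzero minor of it on the rows f has
    absolute value at least q^-S with S = \sum_i a_f(i), so the norm is at least |b|^j q^-S; the
    factor |b|^j cancels against the covolume. *)
Lemma alpha_le a : (0 < d)%N ->
  (alpha R (ytmat a) <= (q `^ ((spread a)%:R / d%:R))%:E)%E.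
Proof.
move=> d0; have [b [h [c [b0 hS cS gE]]]] := repr_ytmat a.
rewrite /alpha; set g := (repr (repr (ytmat a)))^-1%g in gE *.
apply: ge_ereal_sup => _ [j [v [_ vL vfree ->]]].
have /choice[p pP] : forall i, exists p : 'cV[L]_d,
    (forall l, lpoly (p l 0)) /\ tnth v i = val g *m p.
  by move=> i; have [p pl pE] := vL i; exists p.
(* The factor c preserves k[t]^d, so it is absorbed into the polynomial coordinates. *)
pose P : 'M[L]_(d, j) := \matrix_(l, i) (val c *m p i) l 0.
have polyP l i : lpoly (P l i).
  have [S0 S1 SD SM] := lpoly_subring k.
  rewrite !mxE; apply: (big_ind (@lpoly k)) => // m _; apply: SM; first exact: cS.1.
  exact: (pP i).1.
pose V : 'M[L]_(d, j) := \matrix_(l, i) tnth v i l 0.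
have VE : V = (b *: val (h * (tmat k a)^-1)%g) *m P.
  apply/matrixP => l i; rewrite mxE (pP i).2 gE [val (h * (tmat k a)^-1 * c)%g]/=.
  rewrite -!scalemxAl mxE [RHS]mxE -mulmxA; congr (_ * _); rewrite !mxE.
  by apply: eq_bigr => m _; rewrite [P m i]mxE.
have [f finj fP] := free_minor vfree VE.
pose A : 'M[L]_(j, d) := rowsub f (val h^-1%g).
have rA i l : lring (A i l) by rewrite mxE; exact: hS.2.
have := abs_minor_int_le R v rA; rewrite -/V.
have -> : A *m V = b *: (diag_mx (\row_i lmon k (- (a (f i))%:Z)) *m rowsub f P).
  rewrite /A mul_rowsub_mx VE.
  have -> : val h^-1%g *m (b *: val (h * (tmat k a)^-1)%g *m P) =
      b *: (val (tmat k a)^-1%g *m P).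
    rewrite -scalemxAl -scalemxAr [val (h * (tmat k a)^-1)%g]/=.
    rewrite -[val h *m _ *m P]mulmxA.
    by congr (_ *: _); apply: mulKmx; exact: (valP h).
  rewrite /tmat -tdiagN; apply/matrixP => i l; rewrite mxE [LHS]mxE [RHS]mxE.
  by rewrite tdiagMl mul_diag_mx !mxE.
set S := (\sum_i a (f i))%N; set N := wedge_norm R v.
rewrite (detZ b) det_mulmx det_diag absM absX absM.
rewrite (eq_bigr (fun i => lmon k (- (a (f i))%:Z))) => [|i _]; last by rewrite mxE.
rewrite lmon_prod abs_lmon sumrN => leN.
have {leN} leN : abs b ^+ j * q `^ (- S%:R) <= N.
  apply: le_trans leN; rewrite ler_wpM2l ?exprn_ge0 ?abs_ge0//.
  rewrite q_exp_sum ler_peMr ?powR_ge0//.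
  apply: lpoly_abs_ge1 => //.
  apply: (subring_det (lpoly_subring k) (@lpolyN k)) => i l.
  by rewrite mxE; exact: polyP.
have q0 : q != 0 by rewrite gt_eqF// q_gt0.
have bj0 : 0 < abs b ^+ j by rewrite exprn_gt0// abs_gt0.
have D0 : 0 < abs b ^+ j * q `^ (- S%:R) by rewrite mulr_gt0// powR_gt0// q_gt0.
rewrite lee_fin (covol_scale hS cS gE) covol_powR ?abs_ge0//.
apply: (@le_trans _ _ (abs b ^+ j * q `^ (- ((\sum_i a i)%:R * j%:R / d%:R)) *
    (abs b ^+ j * q `^ (- S%:R))^-1)).
  rewrite ler_wpM2l ?mulr_ge0 ?powR_ge0 ?(ltW bj0)//.
  by rewrite lef_pV2// posrE (lt_le_trans D0).
rewrite invfM -powRN opprK mulrACA divff ?gt_eqF// mul1r -powRD ?q0 ?implybT//.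
(* The exponent left is S - j (\sum_l a_l) / d, at most h(a) / d by [spread_ge]. *)
apply: ler_powR; first exact: ltW (q_gt1 k R).
have dR : 0 < d%:R :> R by rewrite ltr0n.
rewrite -(ler_pM2r dR) mulrDl mulNr !divfK ?gt_eqF//.
rewrite addrC lerBlDr -!natrM -natrD ler_nat [(S * d)%N]mulnC [(_ * j)%N]mulnC.
exact: spread_ge.
Qed.

(** The case j = 1 for the lattice vector g c^-1 e_i0 = b t^(-a_i0) h e_i0, whose norm is at most
    |b| q^(-a_i0) because h is integral. *)
Lemma alpha_ge a (i0 : 'I_d) :
  ((q `^ ((a i0)%:R - (\sum_i a i)%:R / d%:R))%:E <= alpha R (ytmat a))%E.
Proof.
have d0 : (0 < d)%N by exact: leq_ltn_trans (leq0n i0) (ltn_ord i0).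
have [b [h [c [b0 hS cS gE]]]] := repr_ytmat a.
rewrite /alpha; set g := (repr (repr (ytmat a)))^-1%g in gE *.
pose e : 'cV[L]_d := delta_mx i0 0.
pose w : 'cV[L]_d := val g *m (val c^-1%g *m e).
have wE : w = (b * lmon k (- (a i0)%:Z)) *: (val h *m e).
  rewrite /w gE [val (h * _ * c)%g]/= -scalemxAl -scalerA; congr (_ *: _).
  rewrite -mulmxA mulKVmx ?(valP c)// -mulmxA [RHS]scalemxAr; congr (_ *m _).
  rewrite -[invmx _]/(val (tmat k a)^-1%g) /tmat -tdiagN.
  apply/matrixP => i l; rewrite tdiagMl [RHS]mxE !mxE.
  by case: eqP => [->|_]; rewrite /= ?mulr0.
have w0 : w != 0.
  apply/eqP => w0; have := congr1 (mulmx (invmx (val h))) w0.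
  rewrite wE mulmx0 -scalemxAr mulKmx ?(valP h)// => /matrixP/(_ i0 0) /eqP.
  by rewrite !mxE !eqxx mulr1 mulf_eq0 (negPf b0) (negPf (lmon_neq0 _ _)).
pose v : 1.-tuple 'cV[L]_d := [tuple w].
have wcE I : wedge_coord v I = w (I ord0) 0 by rewrite /wedge_coord det_mx11 mxE.
have wi i : abs (w i 0) <= abs b * q ^ (- (a i0)%:Z).
  rewrite wE mxE absM absM abs_lmon -[leRHS]mulr1.
  rewrite ler_wpM2l ?mulr_ge0 ?abs_ge0 ?exprz_ge0 ?ler0n//.
  rewrite -(expr0z q); apply/abs_le; rewrite mxE; apply: dle_sum => l _.
  rewrite mxE andbT; case: (l == i0); last by rewrite mulr0.
  by rewrite mulr1; exact: hS.1.
have Nle : wedge_norm R v <= abs b * q ^ (- (a i0)%:Z).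
  apply: bigmax_le => [|I _]; last by rewrite wcE.
  by rewrite mulr_ge0 ?abs_ge0 ?exprz_ge0 ?ler0n.
have N0 : 0 < wedge_norm R v.
  have [i wi0] : exists i, w i 0 != 0.
    apply/existsP; apply: contraNT w0 => /existsPn w0; apply/eqP/colP => i.
    by rewrite [RHS]mxE; apply/eqP; rewrite -[_ == _]negbK w0.
  have := abs_minor_le R v (fun=> i); rewrite det_mx11 mxE.
  by apply: lt_le_trans; exact: abs_gt0.
apply: le_trans (ereal_sup_ubound _); last first.
  exists 1%N, v; split=> //; last by rewrite seq1_free.
  move=> i; rewrite (ord1 i); exists (val c^-1%g *m e) => // l.
  have [S0 S1 SD SM] := lpoly_subring k.
  rewrite mxE; apply: (big_ind (@lpoly k)) => // m _; apply: SM; first exact: cS.2.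
  by rewrite mxE; case: (_ && _).
rewrite lee_fin (covol_scale hS cS gE) covol_powR ?abs_ge0// expr1.
have b1 := abs_gt0 R b0.
have q0 : q != 0 by rewrite gt_eqF// q_gt0.
have D0 : 0 < abs b * q ^ (- (a i0)%:Z) by rewrite mulr_gt0// exprz_gt0// q_gt0.
apply: (@le_trans _ _ (abs b * q `^ (- ((\sum_i a i)%:R * 1 / d%:R)) *
    (abs b * q ^ (- (a i0)%:Z))^-1)); last first.
  by rewrite ler_wpM2l ?mulr_ge0 ?powR_ge0 ?(ltW b1)// lef_pV2// posrE.
rewrite -powR_intmul ?ler0n// invfM -powRN mulrACA divff ?gt_eqF// mul1r.
by rewrite -powRD ?q0 ?implybT// mulr1 rmorphN opprK addrC.
Qed.

End HeightBounds.

(** * Integrals and sums over countable sets *)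

Section IntegralCountable.
Local Open Scope ereal_scope.
Variables (disp : measure_display) (T : measurableType disp) (R : realType).
Variable mu : {measure set T -> \bar R}.
Hypothesis mT : forall A : set T, measurable A.

Lemma integral_singleton (f : T -> \bar R) x :
  \int[mu]_(y in [set x]) f y = f x * mu [set x].
Proof.
rewrite -(integral_cst mu (mT [set x])).
by apply: eq_integral => y /set_mem/= ->.
Qed.

Lemma integral_countable (f : T -> \bar R) : countable [set: T] ->
  (forall x, 0 <= f x) ->
  \int[mu]_x f x = \esum_(x in [set: T]) f x * mu [set x].
Proof.
move=> /countable_injP[e einj] f0; pose F n := [set x | e x = n].
have tF : trivIset setT F by move=> m n _ _ [x [/= <- <-]].
have FT : setT = \bigcup_n F n by apply/seteqP; split=> // x _; exists (e x).
rewrite FT ge0_integral_bigcup//.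
rewrite nneseries_sum_bigcup//; last by move=> x; rewrite mule_ge0.
apply: eq_eseriesr => n _; have [[x xn]|nF] := pselect (exists x, F n x); last first.
  rewrite (_ : F n = set0) ?integral_set0 ?esum_set0//; apply/seteqP.
  by split=> // x Fx; case: nF; exists x.
have -> : F n = [set x].
  apply/seteqP; split=> [y /= yn|_ ->//]; apply: einj; rewrite ?inE//.
  by rewrite yn.
by rewrite integral_singleton esum_set1// mule_ge0.
Qed.

End IntegralCountable.

(** A finite set of maps lies in a box of maps with values below M, over which the sum is a product
    of partial geometric series, each at most 1 / (1 - x). *)
Lemma esum_geometric_lty (R : realType) (I : finType) (x : R) : 0 < x < 1 ->
  (\esum_(a in [set: {ffun I -> nat}]) (x ^+ (\sum_i a i)%N)%:E < +oo)%E.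
Proof.
move=> /andP[x0 x1].
apply: (@le_lt_trans _ _ ((1 - x)^-1 ^+ #|I|)%:E); last by rewrite ltry.
apply: ge_ereal_sup => _ [A [finA _] <-].
have [s As] := (finite_seqP _).1 finA.
pose M := (\max_(a <- s) \max_i a i).+1.
have aM a i : A a -> (a i < M)%N.
  rewrite As /= => sa; rewrite /M ltnS.
  by apply: leq_trans (leq_bigmax_seq _ sa isT); exact: (leq_bigmax i).
pose h (f : {ffun I -> 'I_M}) : {ffun I -> nat} := [ffun i => f i : nat].
have hinj : injective h.
  by move=> f g /ffunP fg; apply/ffunP => i; have := fg i; rewrite !ffunE => /val_inj.
apply: (@le_trans _ _ (\sum_(a \in h @` [set` predT]) (x ^+ (\sum_i a i)%N)%:E)).
  apply: lee_fsum_nneg_subset => //; first exact/finite_image/finite_finset.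
    move=> a /set_mem Aa; apply/mem_set; exists [ffun i => Ordinal (aM a i Aa)] => //.
    by apply/ffunP => i; rewrite !ffunE.
  by move=> a _; rewrite lee_fin exprn_ge0// ltW.
rewrite fsbig_image//; last by move=> ? ? _ _; exact: hinj.
rewrite -(bigfs _ (index_enum_uniq _))/=; last by move=> i _; rewrite mem_index_enum.
rewrite sumEFin lee_fin.
have -> : \sum_(f : {ffun I -> 'I_M}) x ^+ (\sum_i h f i) =
    \prod_(i : I) \sum_(j < M) x ^+ j.
  rewrite bigA_distr_bigA; apply: eq_bigr => f _ /=.
  by rewrite expr_sum; apply: eq_bigr => i _; rewrite ffunE.
rewrite prodr_const lerXn2r ?nnegrE ?invr_ge0 ?subr_ge0 ?(ltW x1)//.
  by apply: sumr_ge0 => j _; rewrite exprn_ge0// ltW.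
rewrite -[leRHS]mul1r ler_pdivlMr ?subr_gt0// mulrC -opprB mulNr -subrX1 opprB.
by rewrite gerBl exprn_ge0// ltW.
Qed.

(** * The points of Y and the integral of the height *)

Section DoubleCosetSpace.
Local Open Scope quotient_scope.
Variables (k : finFieldType) (d : nat).
Hypothesis d0 : (0 < d)%N.

(* Grothendieck's splitting theorem, up to twist *)
Lemma ytmat_surj (y : Ydc k d) :
  exists a : {ffun 'I_d -> nat}, (exists i, a i = 0%N) /\ y = ytmat k a.
Proof.
have [c [b [h [cS hS E]]]] := row_reduction (repr (repr y)).
have [i0 _ bmin] := @Order.TotalTheory.arg_minP _ _ _ (Ordinal d0) xpredT b isT.
(* Dividing by the scalar t^(b i0), trivial in PGL_d, makes the least exponent 0 and all exponents
   natural numbers. *)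
pose a : {ffun 'I_d -> nat} := [ffun i => `|b i - b i0|%N].
have aE i : (a i)%:Z = b i - b i0.
  by rewrite ffunE gez0_abs// subr_ge0; exact: bmin.
exists a; split; first by exists i0; rewrite ffunE subrr.
rewrite -[LHS](reprK y); apply/pi_YdcP.
exists (\pi_(PGL k d) c), (\pi_(PGL k d) h^-1%g); split.
- by exists c.
- by exists h^-1%g => //; exact: GLsubV.
transitivity (\pi_(PGL k d) (c * repr (repr y) * h^-1)%g); last first.
  by rewrite -!PGLmulE reprK.
apply/PGL_eqP; exists (lmon k (b i0)); first exact: lmon_neq0.
rewrite E mulgK; apply/matrixP => i j; rewrite !mxE; case: (i == j); last first.
  by rewrite !mulr0n mulr0.
by rewrite !mulr1n aE -lmonD addrC subrK.
Qed.

Lemma Ydc_countable : countable [set: Ydc k d].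
Proof.
have /choice[s sP] := ytmat_surj; apply/countable_injP.
exists (fun y => choice.pickle (s y)) => x y _ _ /(pcan_inj choice.pickleK) sxy.
by rewrite (sP x).2 (sP y).2 sxy.
Qed.

End DoubleCosetSpace.

(** As a i0 = 0, the terms of the double sum with second index i0 already add up to the left
    side. *)
Lemma sum_le_spread (d : nat) (a : 'I_d -> nat) i0 :
  a i0 = 0%N -> (\sum_i a i <= spread a)%N.
Proof.
move=> ai0; apply: leq_sum => i _; rewrite (bigD1 i0)//= ai0 subn0.
exact: leq_addr.
Qed.

(** * Convergence and divergence of the integral of the height *)

Section Integral.
Local Open Scope quotient_scope.
Variables (R : realType) (k : finFieldType) (d : nat) (hd : (2 <= d)%N).
Variables (vol : {measure set (PGL k d) -> \bar R}).
Variables (vol_haar : is_haar vol) (vol_K : vol (PGL_int d) = 1%E).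
Variables (m : {measure set (GammaG k d) -> \bar R}).
Variable (m_quot : is_quotient_measure vol m).
Local Notation q := (#|k|%:R : R).
Implicit Types (a : 'I_d -> nat) (r : R).

Let d0 : (0 < d)%N. Proof. exact: ltnW. Qed.
Let dR : 0 < d%:R :> R. Proof. by rewrite ltr0n. Qed.
Let q0 : 0 < q. Proof. exact: q_gt0. Qed.
Let q1 : 1 < q. Proof. exact: q_gt1. Qed.

(** The number c is the order of the stabilizer, finite by the upper bound; since c times the mass
    is 1, the mass is finite too. *)
Lemma nuY_ytmat a : exists c : R,
  [/\ q ^+ spread a <= c, c <= q ^+ (spread a + d * d) &
    nuY m [set ytmat k a] = c^-1%:E].
Proof.
have := stab_card_ge R k a; have := stab_card_le R k a.
have := stab_card_nuY vol_haar vol_K m_quot (\pi_(PGL k d) (tmat k a)).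
case: (stab_card R _) => // c; rewrite !lee_fin !natrX => cn c_le c_ge.
exists c; split=> //; have c0 : 0 < c by rewrite (lt_le_trans _ c_ge)// exprn_gt0.
move: cn; rewrite -/(ytmat k a); case: (nuY m _) => [x|/eqP|/eqP].
- rewrite -EFinM => -[cx]; congr _%:E; apply: (mulfI (lt0r_neq0 c0)).
  by rewrite cx divff// gt_eqF.
- by rewrite gt0_muley ?lte_fin.
- by rewrite gt0_muleNy ?lte_fin.
Qed.

Lemma alpha_fin a : exists x : R, [/\ alpha R (ytmat k a) = x%:E,
  forall i, q `^ ((a i)%:R - (\sum_i a i)%:R / d%:R) <= x, 0 <= x &
  x <= q `^ ((spread a)%:R / d%:R)].
Proof.
have ge := alpha_ge R k a; have := alpha_le R k a d0.
have ge0 : (0 <= alpha R (ytmat k a))%E.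
  by apply: le_trans (ge (Ordinal d0)); rewrite lee_fin powR_ge0.
move: ge ge0; case: (alpha R _) => // x ge x0 le; exists x.
by split=> // i; have := ge i; rewrite lee_fin.
Qed.

Lemma integral_alpha r :
  (\int[nuY m]_(y in [set: Ydc k d]) (alpha R y `^ r) =
   \esum_(y in [set: Ydc k d]) (alpha R y `^ r * nuY m [set y]))%E.
Proof.
apply: integral_countable; first exact: Ydc_all_measurable.
  exact: Ydc_countable.
by move=> y; exact: poweR_ge0.
Qed.

(** The term at the point of t^a is at most q^(r h(a) / d) q^(-h(a)) = x^h(a) with x = q^(r / d - 1)
    < 1, and h(a) >= \sum_i a_i. The value r = 0 is included because it gives the total mass. *)
Lemma integral_alpha_lty r : 0 <= r < d%:R ->
  (\int[nuY m]_(y in [set: Ydc k d]) (alpha R y `^ r) < +oo)%E.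
Proof.
move=> /andP[r0 rd]; rewrite integral_alpha.
have /choice[s sP] := @ytmat_surj k d d0.
pose x := q `^ (r / d%:R - 1).
have x01 : 0 < x < 1.
  have s0 : 0 < 1 - r / d%:R by rewrite subr_gt0 ltr_pdivrMr// mul1r.
  rewrite powR_gt0//= /x -opprB powRN invf_lt1 ?powR_gt0//.
  have : 1 `^ (1 - r / d%:R) < q `^ (1 - r / d%:R).
    by apply: gt0_ltr_powR => //; rewrite nnegrE// ltW.
  by rewrite powR1.
apply: le_lt_trans (esum_geometric_lty 'I_d x01).
pose w (a : {ffun 'I_d -> nat}) : \bar R := (x ^+ (\sum_i a i)%N)%:E.
apply: (@le_trans _ _ (\esum_(y in [set: Ydc k d]) w (s y)))%E.
  apply: le_esum => y _; have [[i0 si0] {1 2}->] := sP y.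
  have [c [c1 c2 ->]] := nuY_ytmat (s y).
  have [z [-> _ z0 zle]] := alpha_fin (s y).
  rewrite poweR_EFin -EFinM lee_fin; have [/ltW x0 /ltW x1] := andP x01.
  apply: (@le_trans _ _ (x ^+ spread (s y))); last first.
    by rewrite ler_wiXn2l// (sum_le_spread si0).
  have qS : 0 < q ^+ spread (s y) by rewrite exprn_gt0.
  rewrite -powR_mulrn// /x -powRrM mulrBl mul1r powRB ?(gt_eqF q0) ?implybT//.
  rewrite powR_mulrn ?(ltW q0)//; apply: ler_pM => //; first exact: powR_ge0.
  - by rewrite invr_ge0 (le_trans (ltW qS)).
  - have -> : r / d%:R * (spread (s y))%:R = (spread (s y))%:R / d%:R * r by ring.
    by rewrite powRrM ge0_ler_powR// nnegrE powR_ge0.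
  - by rewrite lef_pV2// posrE (lt_le_trans qS).
(* The section s is injective, so the sum over Y is part of the sum over all exponent vectors. *)
rewrite -(@esum_image _ _ _ setT s w) => [|y y' _ _ ss]; last first.
  by rewrite (sP y).2 (sP y').2 ss.
by apply: le_ereal_sup; apply: image_subset => X [finX _]; split.
Qed.

(* For a = (n, 0, ..., 0) the bounds of [alpha_fin] coincide. *)
Lemma integral_alpha_infty r : d%:R <= r ->
  ~ (\int[nuY m]_(y in [set: Ydc k d]) (alpha R y `^ r) < +oo)%E.
Proof.
move=> dr; rewrite integral_alpha; pose i0 := Ordinal d0.
pose a n (i : 'I_d) := if i == i0 then n else 0%N.
have sa n : (\sum_i a n i = n)%N.
  by rewrite (bigD1 i0)//= /a eqxx big1 ?addn0// => i /negPf->.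
have spa n : spread (a n) = (n * d.-1)%N.
  rewrite /spread (bigD1 i0)//= [X in (_ + X)%N]big1 ?addn0 => [|i /negPf ii0].
    rewrite (bigD1 i0)//= subnn add0n.
    rewrite (eq_bigr (fun=> n)) => [|i /negPf ii0]; last by rewrite /a eqxx ii0 subn0.
    by rewrite sum_nat_const cardC1 card_ord mulnC.
  by apply: big1 => j _; rewrite /a ii0.
(* Here h(a) = n (d - 1), and f n = h(a) / d is the exponent in both bounds. *)
pose f (n : nat) := n%:R * (1 - d%:R^-1) : R.
have alphaE n : alpha R (ytmat k (a n)) = (q `^ f n)%:E.
  have [x [-> xge _ xle]] := alpha_fin (a n); congr _%:E; apply/eqP.
  rewrite eq_le; apply/andP; split.
    apply: le_trans xle _; rewrite spa natrM -subn1 natrB// mulrBr mulr1.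
    by rewrite mulrBl mulfK ?gt_eqF// /f mulrBr mulr1.
  by apply: le_trans (xge i0); rewrite sa /f mulrBr mulr1 /a eqxx.
have finj : injective f.
  move=> n n' /mulIf; rewrite subr_eq0 gt_eqF ?invf_lt1 ?ltr1n// => /(_ isT).
  by move/eqP; rewrite eqr_nat => /eqP.
(* The heights q^(f n) tell the points apart. *)
have yinj : injective (fun n => ytmat k (a n)).
  move=> n n' /(congr1 (@alpha R k d)); rewrite !alphaE => -[] /(congr1 (@ln R)).
  rewrite !ln_powR => /mulIf; rewrite gt_eqF ?ln_gt0// => /(_ isT).
  exact: finj.
(* As r >= d, the height to the power r is at least q^h(a), while the mass is at least q^(-h(a) -
   d^2). *)
pose C := q ^- (d * d).
have C0 : 0 < C by rewrite invr_gt0 exprn_gt0.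
have ge_C n : (C%:E <= alpha R (ytmat k (a n)) `^ r * nuY m [set ytmat k (a n)])%E.
  have [c [c1 c2 ->]] := nuY_ytmat (a n).
  have c0 : 0 < c by rewrite (lt_le_trans _ c1)// exprn_gt0.
  rewrite alphaE poweR_EFin -EFinM lee_fin ler_pdivlMr// mulrC ler_pdivrMr ?exprn_gt0//.
  apply: le_trans c2 _; rewrite exprD ler_pM2r ?exprn_gt0// -powRrM.
  rewrite -powR_mulrn ?(ltW q0)// ler_powR ?(ltW q1)// spa natrM.
  have -> : d.-1%:R = (1 - d%:R^-1) * d%:R :> R.
    by rewrite mulrBl mul1r mulVf ?gt_eqF// -subn1 natrB.
  by rewrite /f mulrA ler_wpM2l// mulr_ge0 ?ler0n// subr_ge0 invf_le1// ler1n.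
pose e := (\esum_(y in [set: Ydc k d]) (alpha R y `^ r * nuY m [set y]))%E.
rewrite -/e => fin_int.
have e_ge n : ((n%:R * C)%:E <= e)%E.
  apply: esum_ge; exists ((fun n => ytmat k (a n)) @` `I_n).
    by split => //; exact/finite_image/finite_II.
  rewrite fsbig_image//; last by move=> ? ? _ _; exact: yinj.
  rewrite -(fsbig_ord _ n (fun i =>
    alpha R (ytmat k (a i)) `^ r * nuY m [set ytmat k (a i)])%E).
  have -> : (n%:R * C)%:E = (\sum_(i < n) C%:E)%E.
    by rewrite sumEFin sumr_const card_ord mulr_natl.
  by apply: lee_sum => i _; exact: ge_C.
have := e_ge 0%N; case: e fin_int e_ge => // x _ e_ge _.
have x0 : 0 <= x by have := e_ge 0%N; rewrite mul0r lee_fin.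
have xC : 0 <= x / C by rewrite divr_ge0// ltW.
(* A finite total x would bound n C for every n, which fails for n beyond x / C. *)
have := archi_boundP xC; rewrite ltr_pdivrMr//.
by have := e_ge (Num.bound (x / C)); rewrite lee_fin leNgt => /negP.
Qed.

Lemma nuY_setT_gt0 : (0 < nuY m [set: Ydc k d])%E.
Proof.
have [c [c1 _ nuE]] := nuY_ytmat (fun=> 0%N).
apply: (@lt_le_trans _ _ (nuY m [set ytmat k (fun=> 0%N)])).
  by rewrite nuE lte_fin invr_gt0 (lt_le_trans _ c1)// exprn_gt0.
by apply: le_measure => //; rewrite inE; exact: Ydc_all_measurable.
Qed.

(** The integral at r = 0, where the integrand is 1. *)
Lemma nuY_setT_lty : (nuY m [set: Ydc k d] < +oo)%E.
Proof.
have := @integral_alpha_lty 0; rewrite lexx dR => /(_ isT).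
rewrite (eq_integral (cst 1%E)) => [|y _]; last by rewrite poweRe0.
by rewrite integral_cst ?mul1e//; exact: Ydc_all_measurable.
Qed.

End Integral.

(** * The criterion for [nuY] and its transfer to the probability measure [muY] *)

Unset Implicit Arguments.

Theorem theorem1p2 (R : realType) (Fq : finFieldType) (d : nat) (hd : (2 <= d)%N)
    (vol : {measure set (PGL Fq d) -> \bar R})
    (vol_haar : is_haar vol) (vol_K : vol (PGL_int d) = 1%E)
    (m : {measure set (GammaG Fq d) -> \bar R})
    (m_quot : is_quotient_measure vol m) (r : R) (hr : 0 < r) :
  ((\int[nuY m]_(y in [set: Ydc Fq d]) (alpha R y `^ r) < +oo)%E
     <-> 0 < r < d%:R) /\
  ((\int[muY m]_(y in [set: Ydc Fq d]) (alpha R y `^ r) < +oo)%E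
     <-> 0 < r < d%:R).
Proof.
have nuP : (\int[nuY m]_(y in [set: Ydc Fq d]) (alpha R y `^ r) < +oo)%E
    <-> 0 < r < d%:R.
  split=> [fin_int|/andP[_ rd]]; last first.
    by apply: (integral_alpha_lty hd vol_haar vol_K m_quot); rewrite ltW.
  rewrite hr ltNge; apply/negP => dr.
  exact: (integral_alpha_infty hd vol_haar vol_K m_quot dr).
split=> //; rewrite -nuP /muY.
set c := NngNum _.
(* Both positivity and finiteness of the total mass enter: [fine] sends an infinite value to 0, and
   the inverse of 0 is 0. *)
have c0 : 0 < c%:num.
  rewrite /= invr_gt0 fine_gt0// (nuY_setT_gt0 vol_haar vol_K m_quot).
  exact: (nuY_setT_lty hd vol_haar vol_K m_quot).
rewrite ge0_integral_mscale//; last 2 first.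
- exact: Ydc_all_measurable_fun.
- by move=> y _; exact: poweR_ge0.
have int_ge0 : (0 <= \int[nuY m]_(y in [set: Ydc Fq d]) (alpha R y `^ r))%E.
  by apply: integral_ge0 => y _; exact: poweR_ge0.
move: int_ge0; case: (integral _ _ _) => [x|_|//].
  by move=> _; split=> _; rewrite ltry.
by rewrite gt0_muley ?lte_fin.
Qed.
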